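(* Let $X$ be a set of infinite regular cardinality $\kappa$. The maximal clones on $X$ which contain all bijections of $X$ but not all unary functions on $X$ are exactly those of the form $\mathrm{Pol}(\mathcal G)$, where $\mathcal G\in\{\mathcal A,\mathcal B,\mathcal E,\mathcal F\}\cup\{\mathcal G_\lambda: 1\leq\lambda\leq\kappa,\ \lambda\text{ a cardinal}\}$ is one of the following submonoids of $\mathcal O^{(1)}$: 1. $\mathcal A=\{f\in\mathcal O^{(1)}: f^{-1}[\{y\}]\text{ is small for almost all }y\in X\}$; 2. $\mathcal B=\{f\in\mathcal O^{(1)}: f^{-1}[\{y\}]\text{ is small for all }y\in X\}$; 3. $\mathcal E=\{f\in\mathcal O^{(1)}: f\text{ is almost surjective}\}$; 4. $\mathcal F=\{f\in\mathcal O^{(1)}: f\text{ is almost surjective or constant}\}$; 5. $\mathcal G_\lambda=\{f\in\mathcal O^{(1)}:\text{ if }A\subseteq X\text{ has cardinality }\lambda\text{ then }|X\setminus f[X\setminus A]|\geq\lambda\}$.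
   Context: $\mathcal O^{(n)}$ is the set of all functions $X^n\to X$ and $\mathcal O=\bigcup_{n\geq 1}\mathcal O^{(n)}$. A clone on $X$ is a subset of $\mathcal O$ containing all projections and closed under composition; a clone is maximal if it is a dual atom (maximal proper element, i.e. maximal among clones $\neq\mathcal O$) in the lattice of all clones on $X$ ordered by inclusion. A submonoid of $\mathcal O^{(1)}$ is a set of unary functions closed under composition and containing the identity. A subset of $X$ is small if its cardinality is less than $\kappa=|X|$. A property holds for almost all $y\in X$ if the set of $y$ for which it fails is small. A function $f\in\mathcal O^{(1)}$ is almost surjective if $X\setminus f[X]$ is small. For $\mathcal G\subseteq\mathcal O^{(1)}$, $\mathrm{Pol}(\mathcal G)$ is the set of all $f\in\mathcal O$, say of arity $n$, such that $f(g_1,\ldots,g_n)\in\mathcal G$ for all $g_1,\ldots,g_n\in\mathcal G$, where $f(g_1,\ldots,g_n)(x)=f(g_1(x),\ldots,g_n(x))$. *)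

(* Defs.v *)
From mathcomp Require Import all_boot.
From mathcomp Require Import boolp classical_sets functions cardinality.

Set Implicit Arguments.
Unset Strict Implicit.
Unset Printing Implicit Defensive.

Local Open Scope classical_set_scope.
Local Open Scope card_scope.

Section Cardinals.
Variable X : Type.

Definition small (A : set X) : Prop :=
  A #<= [set: X] /\ ~ ([set: X] #<= A).

Definition almost_all (P : X -> Prop) : Prop := small [set y | ~ P y].

(* |X| is regular: a union of fewer than |X| sets, each of size less than |X|,
   has size less than |X|. An index set of fewer than |X| elements may be taken
   to be a small subset D of X. *)
Definition infinite_regular : Prop :=
  infinite_set [set: X] /\
  forall (D : set X) (F : X -> set X),
    small D -> (forall i, D i -> small (F i)) ->
    small (\bigcup_(i in D) F i).

End Cardinals.

Section Clones.
Variable X : Type.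

Definition nary (n : nat) : Type := ('I_n -> X) -> X.

(* The disjoint union of the sets of n-ary functions over n >= 1: an element
   existT _ n f is a function f of arity n.+1. *)
Definition operation : Type := {n : nat & nary n.+1}.

Definition op n (f : nary n.+1) : operation := existT (fun n => nary n.+1) n f.

Definition unary_op (f : X -> X) : operation :=
  @op 0 (fun x => f (x ord0)).

Record is_clone (C : set operation) : Prop := IsClone {
  clone_proj : forall n (i : 'I_n.+1), C (op (fun x : 'I_n.+1 -> X => x i));
  clone_comp : forall n m (f : nary n.+1) (g : 'I_n.+1 -> nary m.+1),
    C (op f) -> (forall i, C (op (g i))) ->
    C (op (fun x : 'I_m.+1 -> X => f (fun i => g i x)))
}.

Definition maximal_clone (C : set operation) : Prop :=
  [/\ is_clone C, C <> setT &
      forall D : set operation,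
        is_clone D -> C `<=` D -> D <> setT -> D = C].

Definition is_submonoid (G : set (X -> X)) : Prop :=
  G id /\ forall f g, G f -> G g -> G (f \o g).

Definition Pol (G : set (X -> X)) : set operation :=
  [set o | let: existT n f := o in
     forall g : 'I_n.+1 -> (X -> X),
       (forall i, G (g i)) -> G (fun x => f (fun i => g i x))].

Definition almost_surjective (f : X -> X) : Prop := small (~` range f).

Definition monA : set (X -> X) :=
  [set f | almost_all (fun y => small (f @^-1` [set y]))].

Definition monB : set (X -> X) :=
  [set f | forall y, small (f @^-1` [set y])].

Definition monE : set (X -> X) := [set f | almost_surjective f].

Definition monF : set (X -> X) :=
  [set f | almost_surjective f \/ exists c, forall x, f x = c].

(* The cardinal lambda is given as the cardinality of a set L. *)
Definition monG (L : set X) : set (X -> X) :=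
  [set f | forall A : set X, A #= L -> L #<= ~` (f @` (~` A))].

(* The cardinals lambda with 1 <= lambda <= |X| are the cardinalities of the
   nonempty subsets L of X. *)
Inductive listed_monoid : set (X -> X) -> Prop :=
| listed_A : listed_monoid monA
| listed_B : listed_monoid monB
| listed_E : listed_monoid monE
| listed_F : listed_monoid monF
| listed_G (L : set X) : L !=set0 -> listed_monoid (monG L).

End Clones.

(* Main.v *)
Require Import Defs.
From mathcomp Require Import all_boot.
From mathcomp Require Import boolp classical_sets functions cardinality wochoice.

Set Implicit Arguments.
Unset Strict Implicit.
Unset Printing Implicit Defensive.

Local Open Scope classical_set_scope.
Local Open Scope card_scope.

(** Let kappa be the cardinality of X. A set is large if kappa embeds into it, and a
    set is co-large if its complement is large. The functions in Pol G of arity one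
    are the members of G, so the theorem describes which clones above the
    permutations are maximal in terms of their unary parts.

    The centre of the proof is a dichotomy, unary_sub_or_listed. Call an operation
    almost unary if for some coordinate it takes fewer than kappa values whenever
    that coordinate is fixed. A clone D that contains the permutations and an
    operation that is not almost unary either contains every unary function or lies
    below one of the listed Pol G.

    The theorem follows. The almost unary operations form a proper clone that
    contains all unary functions; a maximal clone that does not contain all of them
    therefore has a member that is not almost unary, lies below a listed Pol G, and
    equals it by maximality. Conversely, each listed Pol G contains an operation
    that is injective on a copy of the square of X. It is not almost unary, and
    together with all unary functions it generates every operation. So a proper
    clone above Pol G lies below some listed Pol H; and no two different listed
    clones are comparable (Pol_listed_inj), whence H = G.

    For the dichotomy, let D lie below no listed Pol G. Composition with
    permutations on both sides makes membership in D depend, for a unary function,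
    only on the sizes of its fibres and of the complement of its range. The witness
    that D is not below Pol B yields a unary member with a large fibre, and the one
    for Pol A then yields a member phi with many large fibres (nonA_manyfib). If the
    range of phi is co-large, D contains every function with co-large range and
    large nonempty fibres (M_bigfib_of_manyfib). If the range of phi has a small
    complement, the witnesses for the monoids G_L, used for L as large as the
    smallest complement of a range that occurs, make that complement empty
    (M_bigfib_surj); the witnesses for E and F and the operation that is not almost
    unary then lead back to the first case (M_manyfib_colarge). Now the witness for
    L = X followed by those for small L gives all functions whose nonempty fibres
    are large (M_bigfib). Finally the operation that is not almost unary splits
    fibres: it gives all functions with at least one large fibre (M_large_fiber),
    from these an injection with co-large range (M_injective), and any function is a
    projection of the square composed with such an injection (M_full).

    Regularity enters as a pigeonhole principle (large_pigeonhole), and the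
    simultaneous choices of kappa many points are made along a well-order of type
    kappa (transfinite_choice). *)

(** * Large and small sets *)

(** Having cardinality at least that of X, for subsets of an arbitrary type; the
    small subsets of X are those that are not large. *)
Definition large (X T : Type) (A : set T) : Prop :=
  exists g : X -> T, injective g /\ forall x, A (g x).

Lemma well_order_strict T : exists lt : T -> T -> Prop,
  [/\ well_founded lt, forall x y, [\/ lt x y, x = y | lt y x]
    & forall x y z, lt x y -> lt y z -> lt x z].
Proof.
have [R Rwo] := well_ordering_principle {classic T}.
have Rmin (A : set T) : A !=set0 -> exists z, A z /\ forall y, A y -> R z y.
  move=> [x Ax]; have [|z [[zA zm] _]] := Rwo [pred x : {classic T} | `[< A x >]].
    by exists x; apply/asboolP.
  by exists z; split=> [|y Ay]; [exact/asboolP|apply: zm; apply/asboolP].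
have Runiq (A : set T) x y : A x -> A y -> (forall z, A z -> R x z) ->
    (forall z, A z -> R y z) -> x = y.
  move=> Ax Ay xm ym.
  have [|z [_ zu]] := Rwo [pred x : {classic T} | `[< A x >]].
    by exists x; apply/asboolP.
  have zE w : A w -> (forall z, A z -> R w z) -> z = w.
    by move=> Aw wm; apply: zu; split=> [|v /asboolP/wm//]; apply/asboolP.
  by rewrite -(zE x Ax xm) (zE y Ay ym).
have Rtot x y : R x y \/ R y x.
  have [|z [[->|->] zm]] := Rmin [set x; y]; first by exists x; left.
    by left; apply: zm; right.
  by right; apply: zm; left.
have Rrefl x : R x x by case: (Rtot x x).
have Ranti x y : R x y -> R y x -> x = y.
  by move=> xy yx; apply: (@Runiq [set x; y]) => [| |z [] ->|z [] ->] //=; auto.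
have Rtr x y z : R x y -> R y z -> R x z.
  move=> xy yz; have [|w [[[]|] ->]] := Rmin [set x; y; z].
  - by exists x; left; left.
  - by move/(_ z); apply; right.
  - move=> /(_ x) yx; suff -> : x = y by [].
    by apply: Ranti => //; apply: yx; left; left.
  - move=> zm; have zx : R z x by apply: zm; left; left.
    have zy : R z y by apply: zm; left; right.
    by have e := Ranti _ _ yz zy; rewrite -e.
exists (fun x y => R x y /\ x <> y); split.
- move=> x; apply: contrapT => nAx.
  have [|z [nAz zm]] := Rmin [set x | ~ Acc (fun x y => R x y /\ x <> y) x].
    by exists x.
  apply: nAz; constructor=> y [yz nyz]; apply: contrapT => nAy.
  by apply: nyz; apply: Ranti => //; apply: zm.
- move=> x y; have [xy|nxy] := pselect (x = y); first by constructor 2.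
  by have [] := Rtot x y; [constructor 1|constructor 3]; split=> // /esym.
- move=> x y z [xy nxy] [yz nyz]; split; first exact: Rtr yz.
  by move=> xz; apply: nxy; apply: Ranti => //; rewrite xz.
Qed.

Lemma card_leTE X T (A : set T) : [set: X] #<= A <-> large X A.
Proof.
split=> [/card_leP[f]|[g [ginj gA]]].
- exists (fun x => val (f (SigSub (mem_set (I : [set: X] x))))); split=> [x y|x].
    move=> /val_inj /'inj_f; rewrite !inE => /(_ I I) e.
    by have := congr1 val e.
  by apply: set_mem; apply: valP.
- suff [f] : $|{injfun [set: X] >-> A}| by exact: (inj_card_le f).
  apply/injfunPex; exists g => [x _|x y _ _]; [exact: gA|exact: ginj].
Qed.

Section Cardinals.
Variable X : Type.
Local Notation large := (@large X _).

Lemma smallE (A : set X) : small A <-> ~ large A.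
Proof.
split=> [[_ nA]|nA]; first by apply: contra_not nA => /card_leTE.
split; first exact: card_leT.
by apply: contra_not nA => /card_leTE.
Qed.

Lemma large_setT : large [set: X].
Proof. by exists id; split. Qed.

Lemma large_sub T (A B : set T) : A `<=` B -> large A -> large B.
Proof. by move=> AB [g [gi gA]]; exists g; split=> // x; apply: AB. Qed.

Lemma large_range T (g : X -> T) : injective g -> large (range g).
Proof. by move=> gi; exists g; split=> // x; exists x. Qed.

Lemma large_image T U (F : T -> U) (D : set T) : large (F @` D) -> large D.
Proof.
move=> [g [gi gD]].
have /choice[h hP] : forall x, exists t, D t /\ F t = g x.
  by move=> x; have [t Dt <-] := gD x; exists t.
exists h; split=> [x y e|x]; last by case: (hP x).
by apply: gi; rewrite -(hP x).2 -(hP y).2 e.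
Qed.

Lemma image_large T U (F : T -> U) (D : set T) :
  (forall x y, D x -> D y -> F x = F y -> x = y) -> large D -> large (F @` D).
Proof.
move=> Fi [g [gi gD]]; exists (F \o g); split=> [x y /= /Fi e|x].
  by apply: gi; apply: e.
by exists (g x).
Qed.

Hypothesis hX : infinite_regular X.

Lemma not_large_finite T (A : set T) : finite_set A -> ~ large A.
Proof. by move=> fA /card_leTE/card_le_finite/(_ fA); have [] := hX. Qed.

Lemma X_inhabited : inhabited X.
Proof. by have [/infinite_setN0[x _] _] := hX; exists. Qed.

(** This is what regularity is used for: the fibres of F over its small range cover
    D, so they cannot all be small. *)
Lemma large_pigeonhole T U (D : set T) (F : T -> U) :
  large D -> ~ large (F @` D) -> exists u, large (D `&` F @^-1` [set u]).
Proof.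
move=> [g [gi gD]] FD; apply: contrapT => noU.
pose F' := F \o g.
have /choice[r rP] : forall u, exists x, range F' u -> F' x = u.
  move=> u; have [[x _ xu]|nu] := pselect (range F' u); first by exists x.
  by have [x] := X_inhabited; exists x => /nu.
have [_ reg] := hX.
have : ~ small (\bigcup_(i in r @` range F') [set x | F' x = F' i]).
  move=> /smallE; apply; apply: (large_sub _ large_setT) => x _.
  by exists (r (F' x)); [exists (F' x) => //; exists x|rewrite /= rP//; exists x].
apply; apply: reg.
  apply/smallE => /large_image; apply: contra_not FD; apply: large_sub.
  by move=> _ [x _ <-]; exists (g x).
move=> i _; apply/smallE => -[h [hi hP]]; apply: noU; exists (F' i).
exists (g \o h); split=> [x y /gi/hi//|x]; split; [exact: gD|exact: hP].
Qed.

Lemma large_cover T U (A : set T) (I : set U) (F : U -> set T) :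
  large A -> ~ large I -> (forall a, A a -> exists i, I i /\ F i a) ->
  exists i, I i /\ large (A `&` F i).
Proof.
move=> [g [gi gA]] nI AF; have [x0] := X_inhabited.
have /choice[f fP] : forall x, exists i, I i /\ F i (g x).
  by move=> x; apply: AF.
have [|i [h [hi hP]]] := @large_pigeonhole _ _ setT f large_setT.
  by apply: contra_not nI; apply: large_sub => _ [x _ <-]; case: (fP x).
exists i; split; first by have [_ <-] := hP x0; case: (fP (h x0)).
exists (g \o h); split=> [x y /gi/hi//|x]; split; first exact: gA.
by have [_ <-] := hP x; case: (fP (h x)).
Qed.

Lemma large_setU T (A B : set T) : large (A `|` B) -> large A \/ large B.
Proof.
move=> lAB.
have [||i [_]] := @large_cover _ bool _ setT (fun b => if b then A else B) lAB.
- by apply: not_large_finite.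
- by move=> a [Aa|Ba]; [exists true|exists false].
by case: i => l; [left|right]; apply: large_sub l => x [].
Qed.

Lemma large_setD T (A B : set T) : large A -> ~ large B -> large (A `\` B).
Proof.
move=> lA nB; suff /large_setU[] : large (A `\` B `|` B) by [].
by apply: large_sub lA => x Ax; have [Bx|nBx] := pselect (B x); [right|left].
Qed.

Lemma large_setC (B : set X) : ~ large B -> large (~` B).
Proof. by move=> nB; rewrite -setTD; apply: large_setD => //; exact: large_setT. Qed.

Lemma large_enum T (A : set T) (j : T -> X) :
  injective j -> large A -> exists e : X -> T, injective e /\ range e = A.
Proof.
move=> ji lA; have [x0] := X_inhabited.
have [t0] : inhabited T by case: lA => g _; exists; apply: g.
have : [set: X] #= A.
  apply: Cantor_Bernstein; first exact/card_leTE.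
  suff [f] : $|{injfun A >-> [set: X]}| by exact: (inj_card_le f).
  by apply/injfunPex; exists j => // x y _ _ /ji.
move=> /card_bijP[f [f' fK f'K]].
pose s x : [set: X] := SigSub (mem_set (I : [set: X] x)).
have sK (z : [set: X]) : s (val z) = z by apply: val_inj.
exists (fun x => val (f (s x))); split=> [x y /val_inj /(can_inj fK) e|].
  by have := congr1 val e.
apply/seteqP; split=> [_ [x _ <-]|y Ay]; first by apply: set_mem; exact: valP.
exists (val (f' (SigSub (mem_set Ay)))) => //.
by rewrite sK f'K.
Qed.

Lemma large_enumX (A : set X) :
  large A -> exists e : X -> X, injective e /\ range e = A.
Proof. by apply: (@large_enum _ A id). Qed.


(** * Choice along a well-order *)

(** Cutting a well-order at the first point whose initial segment is large gives one
    of the order type of an initial ordinal. *)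
Lemma initial_order : exists lt : X -> X -> Prop,
  [/\ well_founded lt, forall x y, [\/ lt x y, x = y | lt y x],
      forall x y z, lt x y -> lt y z -> lt x z & forall x, ~ large [set y | lt y x]].
Proof.
have [lt [ltwf lttot lttr]] := well_order_strict X.
have [[x0 lx0]|nl] := pselect (exists x, large [set y | lt y x]); last first.
  by exists lt; split=> // x lx; apply: nl; exists x.
have [x [lx xm]] : exists x, large [set y | lt y x] /\
    forall z, lt z x -> ~ large [set y | lt y z].
  elim/(well_founded_ind ltwf): x0 lx0 => x IH lx.
  have [[z [zx lz]]|nz] := pselect (exists z, lt z x /\ large [set y | lt y z]).
    exact: IH lz.
  by exists x; split=> // z zx lz; apply: nz; exists z.
have [e [ei eR]] := large_enumX lx.
have ex y : lt (e y) x by rewrite -/([set y | lt y x] (e y)) -eR; exists y.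
exists (fun a b => lt (e a) (e b)); split.
- move=> a; move: {2}(e a) (erefl (e a)) => z.
  elim/(well_founded_ind ltwf): z a => z IH a az.
  by constructor=> b ba; apply: IH erefl; rewrite -az.
- move=> a b; have [ab|/ei ab|ab] := lttot (e a) (e b);
    by [constructor 1|constructor 2|constructor 3].
- by move=> a b c; apply: lttr.
- move=> a la; apply: (xm (e a)) => //.
  have : large (e @` [set b | lt (e b) (e a)]).
    by apply: image_large la => b c _ _ /ei.
  by apply: large_sub => _ [b ba <-].
Qed.

(** Simultaneous choice along a well-order with small initial segments: at each
    stage the choices already made exclude only a small part of R t. *)
Lemma transfinite_choice T U (lt : T -> T -> Prop) (R : T -> set U)
    (K : U -> set U) : well_founded lt ->
    (forall t, ~ large [set s | lt s t]) -> (forall t, large (R t)) ->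
    (forall t u, ~ large (R t `&` K u)) ->
  exists g : T -> U, forall t, R t (g t) /\ forall s, lt s t -> ~ K (g s) (g t).
Proof.
move=> ltwf lts Rl RK.
pose good t (rec : forall s, lt s t -> U) :=
  [set z | R t z /\ forall s (h : lt s t), ~ K (rec s h) z].
have goodP t rec : exists z, good t rec z.
  apply: contrapT => /forallNP noz.
  have [|s [st]] := @large_cover _ _ (R t) [set s | lt s t]
      (fun s => [set z | exists h : lt s t, K (rec s h) z]) (Rl t) (@lts t).
    move=> z Rz; apply: contrapT => ns; apply: (noz z); split=> // s h Kz.
    by apply: ns; exists s; split=> //; exists h.
  move=> l; apply: (RK t (rec s st)); apply: large_sub l => z [Rz [h Kz]].
  by split=> //; rewrite (Prop_irrelevance st h).
pose step t rec := projT1 (cid (goodP t rec)).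
have stepP t rec : good t rec (step t rec) := projT2 (cid (goodP t rec)).
pose g := Fix ltwf (fun=> U) step.
have gE t : g t = step t (fun s _ => g s).
  rewrite /g Fix_eq // => {}t f f' ff'; congr (step t _).
  by apply: functional_extensionality_dep => s; apply/funext => h.
by exists g => t; rewrite gE; have [? ?] := stepP t (fun s _ => g s).
Qed.

(** * The square of X *)

Lemma if_holds (P : Prop) T (a b : T) : P -> (if pselect P then a else b) = a.
Proof. by case: pselect. Qed.

Lemma if_fails (P : Prop) T (a b : T) : ~ P -> (if pselect P then a else b) = b.
Proof. by case: pselect. Qed.

Lemma inj_surj_bij T U (f : T -> U) :
  injective f -> (forall y, exists x, f x = y) -> bijective f.
Proof.
move=> fi /choice[g gK]; exists g => // x; apply: fi; exact: gK.
Qed.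

Lemma bij_surj T U (f : T -> U) : bijective f -> forall y, exists x, f x = y.
Proof. by move=> [g _ gK] y; exists (g y). Qed.

(** Pairs are ordered by the larger coordinate first. An initial segment then lies
    in the square of a small set, which is small by regularity, so distinct elements
    of X can be chosen for all pairs in turn. *)
Lemma code_square : exists e : X -> X * X, bijective e.
Proof.
have [lt [ltwf lttot lttr lts]] := initial_order.
have [R [Rwf Rtot _]] := well_order_strict (X * X)%type.
have /choice[mx mxP] : forall p : X * X, exists m,
    (m = p.1 \/ m = p.2) /\ forall a, (a = p.1 \/ a = p.2) -> a = m \/ lt a m.
  move=> [a b] /=; have [ab|ab|ba] := lttot a b.
  - by exists b; split=> [|c [->|->]]; [right|right|left].
  - by exists b; split=> [|c [->|->]]; [right|left|left].
  - by exists a; split=> [|c [->|->]]; [left|left|right].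
pose ltp p q := lt (mx p) (mx q) \/ mx p = mx q /\ R p q.
have ltpwf : well_founded ltp.
  move=> p; move: {2}(mx p) (erefl (mx p)) => m.
  elim/(well_founded_ind ltwf): m p => m IHm p.
  elim/(well_founded_ind Rwf): p => p IHp pm.
  constructor=> q [lqp|[qp Rqp]]; first by apply: (IHm (mx q)); rewrite -?pm.
  by apply: IHp => //; rewrite qp.
have ltps p : ~ large [set q | ltp q p].
  pose S := [set a | a = mx p \/ lt a (mx p)].
  have nS : ~ large S.
    apply: contra_not (lts (mx p)) => l.
    have /large_setU[/(not_large_finite (finite_set1 _))[]|//] :
      large ([set mx p] `|` [set y | lt y (mx p)]) by apply: large_sub l.
  move=> l; have sub q : ltp q p -> S q.1 /\ S q.2.
    have mq a : (a = q.1 \/ a = q.2) -> lt (mx q) (mx p) -> S a.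
      by move=> /(mxP q).2[->|aq qp]; right=> //; apply: lttr qp.
    have mq' a : (a = q.1 \/ a = q.2) -> mx q = mx p -> S a.
      by move=> /(mxP q).2[-> ->|aq e]; [left|right; rewrite -e].
    by move=> [h|[h _]]; split; [apply: mq|apply: mq|apply: mq'|apply: mq'] => //;
      [left|right|left|right].
  have [|a [_ l']] := @large_cover _ _ _ S (fun a => [set q | q.1 = a]) l nS.
    by move=> q /sub[Sq _]; exists q.1.
  apply: nS; apply: large_sub (image_large (F := snd) _ l'); last first.
    by move=> [a1 b1] [a2 b2] [_ /= ->] [_ /= ->] /= ->.
  by move=> _ [q [/sub[]]] + + _ <-.
have [||g gP] := @transfinite_choice _ _ ltp (fun=> [set: X])
    (fun z => [set z]) ltpwf ltps.
- by move=> _; exact: large_setT.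
- by move=> _ z; apply: not_large_finite => //; rewrite setTI; exact: finite_set1.
have gi : injective g.
  have ne p q : ltp p q -> g p <> g q by move=> pq e; apply: (gP q).2 pq _; rewrite e.
  move=> p q e; apply: contrapT => npq.
  have [] : ltp p q \/ ltp q p; last 2 first.
  - by move/ne.
  - by move/ne => /(_ (esym e)).
  have [|m|] := lttot (mx p) (mx q); [by left; left| |by right; left].
  by have [|//|] := Rtot p q; [left; right|right; right].
have [|e [ei eT]] := @large_enum _ [set: X * X] g gi.
  by exists (fun x => (x, x)); split=> // x y [].
exists e; apply: inj_surj_bij => // p.
by have [x _ <-] : range e p; [rewrite eT|exists x].
Qed.

Definition code : X -> X * X := projT1 (cid code_square).
Definition pr1 x := (code x).1.
Definition pr2 x := (code x).2.
Lemma pair_exists : exists pair : X -> X -> X,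
  forall a b, code (pair a b) = (a, b).
Proof.
have [g _ gK] := projT2 (cid code_square).
by exists (fun a b => g (a, b)) => a b; exact: gK.
Qed.
Definition pair : X -> X -> X := projT1 (cid pair_exists).

Lemma code_pair a b : code (pair a b) = (a, b).
Proof. exact: (projT2 (cid pair_exists)). Qed.
Lemma pr1_pair a b : pr1 (pair a b) = a.
Proof. by rewrite /pr1 code_pair. Qed.
Lemma pr2_pair a b : pr2 (pair a b) = b.
Proof. by rewrite /pr2 code_pair. Qed.
Lemma pair_pr x : pair (pr1 x) (pr2 x) = x.
Proof.
apply: (bij_inj (projT2 (cid code_square))).
by rewrite -/code code_pair -surjective_pairing.
Qed.
Lemma pair_inj a b c d : pair a b = pair c d -> a = c /\ b = d.
Proof.
move=> e; have := congr1 pr1 e; have := congr1 pr2 e.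
by rewrite !pr1_pair !pr2_pair.
Qed.

Definition pt : X := projT1 (cid (infinite_setN0 (proj1 hX))).

Lemma another (x : X) : exists y, y <> x.
Proof.
apply: contrapT => /forallNP nx.
apply: (@not_large_finite _ [set x]); first exact: finite_set1.
by apply: (large_sub _ large_setT) => y _; apply: contrapT => /nx.
Qed.

Definition pt' : X := projT1 (cid (another pt)).
Lemma pt'P : pt' <> pt. Proof. exact: projT2 (cid (another pt)). Qed.

(** The standard injection with co-large range, used to leave room in X. *)
Definition half (x : X) : X := pair pt x.

Lemma half_inj : injective half.
Proof. by move=> x y /pair_inj[]. Qed.

Lemma large_half T (g : X -> T) (A : set T) : injective g ->
  (forall x, A (g (pair pt' x))) -> large A.
Proof.
by move=> gi gA; exists (fun x => g (pair pt' x)); split=> // x y /gi/pair_inj[].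
Qed.

Lemma half_colarge T (g : X -> T) : injective g -> large (~` range (g \o half)).
Proof.
move=> gi; by apply: (large_half gi) => x [y _ /gi/pair_inj[/esym/pt'P]].
Qed.

(** Splits the first coordinate into finitely many cases while keeping the value pt
    free for a further one. *)
Lemma idx_exists n : exists f : X -> 'I_n.+1, forall i, exists2 a, a <> pt & f a = i.
Proof.
have [/infiniteP/card_leTE[u [ui _]] _] := hX.
have [g [gi gP]] : large (~` [set pt]).
  by apply: large_setC; apply: not_large_finite; exact: finite_set1.
pose v (i : 'I_n.+1) := g (u i).
have vi : injective v by move=> i j /gi/ui/val_inj.
have /choice[f fP] : forall x, exists i, forall j, x = v j -> i = j.
  move=> x; have [[j ->]|nj] := pselect (exists j, x = v j).
    by exists j => k /vi.
  by exists ord0 => j xj; case: nj; exists j.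
by exists f => i; exists (v i); [exact: gP|exact: fP].
Qed.

(** * Permutations and fibres *)

(** There is equally much room outside the domain and outside the range, so the rest
    can be matched by any bijection. *)
Lemma extend_perm (D : set X) (i : X -> X) :
  (forall x y, D x -> D y -> i x = i y -> x = y) ->
  large (~` D) -> large (~` (i @` D)) ->
  exists2 a : X -> X, bijective a & forall x, D x -> a x = i x.
Proof.
move=> ii /large_enumX[e1 [e1i e1R]] /large_enumX[e2 [e2i e2R]].
have e1D w : (~` D) (e1 w) by rewrite -e1R; exists w.
have e2D w : (~` (i @` D)) (e2 w) by rewrite -e2R; exists w.
pose P x y := (D x /\ y = i x) \/ exists2 w, x = e1 w & y = e2 w.
have /choice[a aP] : forall x, exists y, P x y.
  move=> x; have [Dx|nDx] := pselect (D x); first by exists (i x); left.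
  have [w _ <-] : range e1 x by rewrite e1R.
  by exists (e2 w); right; exists w.
have aD x : D x -> a x = i x.
  by move=> Dx; have [[]|[w xw _]] := aP x => //; case: (e1D w); rewrite -xw.
exists a => //; apply: inj_surj_bij => [x y|y].
  have [[Dx ->]|[w -> ->]] := aP x; have [[Dy ->]|[v -> ->]] := aP y.
  - exact: ii.
  - by move=> e; case: (e2D v); rewrite -e; exists x.
  - by move=> e; case: (e2D w); rewrite e; exists y.
  - by move=> /e2i ->.
have [[x Dx <-]|] := pselect ((i @` D) y); first by exists x; exact: aD.
move=> /= niD; have [w _ <-] : range e2 y by rewrite e2R.
exists (e1 w).
by have [[/e1D]|[v /e1i -> ]] := aP (e1 w).
Qed.

Lemma perm_conj (j q : X -> X) : injective j -> injective q ->
  large (~` range j) -> large (~` range q) ->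
  exists2 a : X -> X, bijective a & forall x, a (j x) = q x.
Proof.
move=> ji qi jl ql.
have /choice[j' j'K] : forall y, exists x, range j y -> j x = y.
  move=> y; have [[x _ <-]|n] := pselect (range j y); first by exists x.
  by exists pt => /n.
have jK x : j' (j x) = x by apply: ji; apply: j'K; exists x.
have [||a ab aP] := @extend_perm (range j) (q \o j') _ jl.
- by move=> _ _ [x _ <-] [y _ <-] /=; rewrite !jK => /qi ->.
- by apply: large_sub ql => y nq [_ [x _ <-]] /=; rewrite jK => e; apply: nq; exists x.
by exists a => // x; rewrite aP /= ?jK //; exists x.
Qed.

Definition bigfib (h : X -> X) := forall x, large [set y | h y = h x].

(** Only the range matters for functions with large fibres: corresponding fibres
    have the same size and are matched separately. *)
Lemma bigfib_conj h1 h2 : bigfib h1 -> bigfib h2 -> range h1 = range h2 ->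
  exists2 b : X -> X, bijective b & forall x, h1 x = h2 (b x).
Proof.
move=> b1 b2 R12.
have enum h : bigfib h -> exists E : X -> X -> X,
    forall z, range h z -> injective (E z) /\ range (E z) = [set y | h y = z].
  move=> bh; suff /choice[E EP] : forall z, exists e : X -> X,
      range h z -> injective e /\ range e = [set y | h y = z] by exists E.
  move=> z; have [[x _ <-]|nz] := pselect (range h z); last by exists id.
  by have [e eP] := large_enumX (bh x); exists e.
have [E1 E1P] := enum _ b1; have [E2 E2P] := enum _ b2.
have onR (h : X -> X) x : range h (h x) by exists x.
have /choice[b bP] : forall x, exists y, exists2 w, x = E1 (h1 x) w & y = E2 (h1 x) w.
  move=> x; have [_ r] := E1P _ (onR h1 x).
  have [w _ e] : range (E1 (h1 x)) x by rewrite r.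
  by exists (E2 (h1 x) w); exists w.
have hb x : h1 x = h2 (b x).
  have [w _ ->] := bP x; have := onR h1 x; rewrite R12 => /E2P[_ r].
  by have : range (E2 (h1 x)) (E2 (h1 x) w) by [exists w]; rewrite r.
exists b => //; apply: inj_surj_bij => [x y e|y].
  have exy : h1 x = h1 y by rewrite !hb e.
  have [w xw bx] := bP x; have [v yv by_] := bP y.
  rewrite xw yv -exy; congr E1.
  have := onR h1 x; rewrite R12 => /E2P[E2i _].
  by apply: E2i; rewrite -bx e by_ exy.
have := onR h2 y; rewrite -R12 => h1y; have [_ r1] := E1P _ h1y.
have [i2 r2] := E2P _ (onR h2 y).
have [w _ yw] : range (E2 (h2 y)) y by rewrite r2.
exists (E1 (h2 y) w).
have h1e : h1 (E1 (h2 y) w) = h2 y.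
  by have : range (E1 (h2 y)) (E1 (h2 y) w) by [exists w]; rewrite r1.
have [v + ->] := bP (E1 (h2 y) w); rewrite h1e => /(E1P _ h1y).1 <-.
exact: yw.
Qed.

(** If a function has a large fibre on the current set, pass to that fibre; both
    alternatives are inherited by subsets, so the functions can be treated one after
    the other. *)
Lemma thin_out T U n (phi : 'I_n -> T -> U) (D : set T) : large D ->
  exists D', [/\ D' `<=` D, large D' & forall i,
    (exists u, forall x, D' x -> phi i x = u) \/
    (forall u, ~ large (D' `&` phi i @^-1` [set u]))].
Proof.
move=> lD.
suff [D' [D'D lD' P]] : exists D', [/\ D' `<=` D, large D' &
    forall i, i \in enum 'I_n -> (exists u, forall x, D' x -> phi i x = u) \/
    (forall u, ~ large (D' `&` phi i @^-1` [set u]))].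
  by exists D'; split=> // i; apply: P; rewrite mem_enum.
elim: (enum 'I_n) => [|i s [D1 [D1D lD1 P1]]]; first by exists D; split.
have [[u lu]|nu] := pselect (exists u, large (D1 `&` phi i @^-1` [set u])).
  exists (D1 `&` phi i @^-1` [set u]); split=> // [x [/D1D]//|j].
  rewrite inE => /orP[/eqP->|/P1[[v vP]|vP]]; first by left; exists u => x [].
    by left; exists v => x [/vP].
  by right=> v; apply: contra_not (vP v); apply: large_sub => x [[]].
exists D1; split=> // j; rewrite inE => /orP[/eqP->|/P1//].
by right=> u lu; apply: nu; exists u.
Qed.

Lemma large_pigeonholes T U n (phi : 'I_n -> T -> U) (D : set T) : large D ->
  (forall i, ~ large (phi i @` D)) ->
  exists D', [/\ D' `<=` D, large D' &
    forall i, exists u, forall x, D' x -> phi i x = u].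
Proof.
move=> /(thin_out phi)[D' [D'D lD' P]] nl; exists D'; split=> // i.
have [//|nf] := P i; have [|u lu] := large_pigeonhole (F := phi i) lD'.
  by apply: contra_not (nl i); apply: large_sub => _ [x /D'D Dx <-]; exists x.
by case: (nf u).
Qed.
(** Take a maximal family G of choice functions that disagree pairwise at every
    member of F. Some member L is exhausted by the values of G, for otherwise G
    could be extended; the members of G then embed L into every other member. *)
Lemma min_card (F : set (set X)) : F !=set0 ->
  exists L, F L /\ forall L', F L' -> L #<= L'.
Proof.
move=> [L0 FL0].
pose P (G : set (set X -> X)) := (forall s L, G s -> F L -> L (s L)) /\
  forall s s' L, G s -> G s' -> F L -> s L = s' L -> s = s'.
have [|G [[Gin Gne] Gmax]] := @Zorn_bigcup _ P.
  move=> H HP Htot; split=> [s L [G HG Gs] FL|s s' L [G HG Gs] [G' HG' Gs'] FL].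
    exact: ((HP _ HG).1 s L).
  have [GG'|G'G] := Htot _ _ HG HG'.
    by apply: ((HP _ HG').2 s s' L) => //; apply: GG'.
  by apply: ((HP _ HG).2 s s' L) => //; apply: G'G.
have [[L [FL Lall]]|noL] := pselect (exists L, F L /\
    forall x, L x -> exists2 s, G s & s L = x).
  exists L; split=> // L' FL'.
  have /choice[k kP] : forall x, exists s, L x -> G s /\ s L = x.
    move=> x; have [/Lall[s Gs e]|nLx] := pselect (L x); first by exists s.
    by exists (fun=> x) => /nLx.
  suff [j] : $|{injfun L >-> L'}| by exact: (inj_card_le j).
  apply/injfunPex; exists (fun x => k x L') => [x Lx|x y].
    by apply: (Gin (k x) L' _ FL'); case: (kP x Lx).
  move=> /set_mem/kP[Gx ex] /set_mem/kP[Gy ey] e.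
  by rewrite -ex -ey (Gne _ _ _ Gx Gy FL' e).
have /choice[s sP] : forall L, exists x, F L -> L x /\ forall s, G s -> s L <> x.
  move=> L; have [FL|nFL] := pselect (F L); last by exists pt => /nFL.
  apply: contrapT => nx; apply: noL; exists L; split=> // x Lx.
  apply: contrapT => ns; apply: nx; exists x => _; split=> // s Gs e.
  by apply: ns; exists s.
exfalso; apply: (Gmax (G `|` [set s])).
  split=> [|]; first by left.
  by move=> /(_ s (or_intror erefl)) /(sP _ FL0).2.
split=> [s' L [Gs|->] FL|s1 s2 L [G1|->] [G2|->] FL //].
- exact: (Gin s' L).
- exact: (sP L FL).1.
- exact: (Gne s1 s2 L).
- by move=> e; case: ((sP L FL).2 _ G1).
- by move=> e; case: ((sP L FL).2 _ G2).
Qed.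

(** The form in which transfinite choice is applied: kappa many points that are
    pairwise not in conflict. *)
Lemma symmetric_choice U (R : X -> set U) (K : U -> U -> Prop) :
    (forall u v, K u v -> K v u) -> (forall t, large (R t)) ->
    (forall t u, ~ large (R t `&` K u)) ->
  exists g : X -> U, (forall t, R t (g t)) /\
    forall s t, s <> t -> ~ K (g s) (g t).
Proof.
move=> Ks Rl RK; have [lt [ltwf lttot _ lts]] := initial_order.
have [g gP] := transfinite_choice ltwf lts Rl RK.
exists g; split=> [t|s t nst]; first by case: (gP t).
have [st|//|ts] := lttot s t; first exact: (gP t).2.
by move=> /Ks; apply: (gP s).2.
Qed.

Lemma large_lift T U (f : T -> U) (A : set T) : large (f @` A) ->
  exists r : X -> T, injective (f \o r) /\ forall x, A (r x).
Proof.
move=> [g [gi gP]].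
have /choice[r rP] : forall x, exists t, A t /\ f t = g x.
  by move=> x; have [t At e] := gP x; exists t.
exists r; split=> [x y /=|x]; last by case: (rP x).
by rewrite (rP x).2 (rP y).2 => /gi.
Qed.

Lemma partial_inverse (r : X -> X) : injective r -> exists r', cancel r r'.
Proof.
move=> ri; have /choice[r' rP] : forall y, exists x, forall z, r z = y -> z = x.
  move=> y; have [[x rx]|nx] := pselect (exists x, r x = y).
    by exists x => z; rewrite -rx => /ri.
  by exists pt => z zy; case: nx; exists z.
by exists r' => x; rewrite -(rP (r x) x).
Qed.

Lemma partial_section (r : X -> X) : exists r', forall x, r (r' (r x)) = r x.
Proof.
have /choice[r' rP] : forall y, exists x, forall z, r z = y -> r x = y.
  move=> y; have [[x rx]|nx] := pselect (exists x, r x = y).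
    by exists x => z.
  by exists pt => z zy; case: nx; exists z.
by exists r' => x; apply: (rP (r x) x).
Qed.

Lemma large_fiber_pr1 T (h : X -> T) x : large [set y | h (pr1 y) = h x].
Proof.
by exists (pair x); split=> [a b /pair_inj[]//|a] /=; rewrite pr1_pair.
Qed.

Lemma bigfib_pr1 (h : X -> X) : bigfib (h \o pr1).
Proof. by move=> x; apply: large_fiber_pr1. Qed.

Lemma range_pr1 T (h : X -> T) : range (h \o pr1) = range h.
Proof.
apply/seteqP; split=> _ [x _ <-]; first by exists (pr1 x).
by exists (pair x x) => //=; rewrite pr1_pair.
Qed.

Lemma perm2 (a b c d : X) : a <> b -> c <> d ->
  exists2 s : X -> X, bijective s & s a = c /\ s b = d.
Proof.
move=> nab ncd.
have fl (u v : X) : large (~` [set u; v]).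
  by apply: large_setC; apply: not_large_finite; exact: finite_set2.
pose i x := if pselect (x = a) then c else d.
have ia : i a = c by rewrite /i; case: pselect.
have ib : i b = d by rewrite /i; case: pselect => // ba; case: nab.
have [|||s sb sP] := @extend_perm [set a; b] i.
- by move=> _ _ [->|->] [->|->]; rewrite ?ia ?ib // => e; case: ncd.
- exact: fl.
- by apply: large_sub (fl c d) => x nx [_ [->|->] e]; apply: nx; rewrite -e ?ia ?ib;
    [left|right].
by exists s => //; split; [rewrite sP ?ia //; left|rewrite sP ?ib //; right].
Qed.

Lemma perm1 (a c : X) : exists2 s : X -> X, bijective s & s a = c.
Proof.
have [b ba] := another a; have [d dc] := another c.
by have [s sb [sa _]] := perm2 (nesym ba) (nesym dc); exists s.
Qed.

(** Half of the complement of A is left out; the other half joins A, so that the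
    range is large whatever the size of A. *)
Lemma cover_colarge (A : set X) : large (~` A) ->
  exists t : X -> X, [/\ injective t, large (~` range t) & A `<=` range t].
Proof.
move=> /large_enumX[e [ei eR]].
have [|t [ti tR]] := @large_enumX (~` range (e \o half)).
  exact: half_colarge.
exists t; rewrite tR setCK; split=> //.
  by apply: large_range; apply: inj_comp ei half_inj.
move=> x Ax [y _ exy]; have : (~` A) x by rewrite -eR -exy; exists (half y).
exact.
Qed.

(** * Clones above the permutations *)

Section CloneOverPermutations.
Variable C : set (operation X).
Hypothesis C_clone : is_clone C.
Hypothesis C_perm : forall f : X -> X, bijective f -> C (unary_op f).
(* Membership in the unary part of C, which is a monoid. *)
Local Notation M f := (C (unary_op f)).

Lemma M_comp f g : M f -> M g -> M (f \o g).
Proof. by move=> Mf Mg; exact: (clone_comp C_clone Mf (fun=> Mg)). Qed.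

Lemma M_perml s f : bijective s -> M f -> M (s \o f).
Proof. by move=> /C_perm; exact: M_comp. Qed.

Lemma M_permr f b : M f -> bijective b -> M (f \o b).
Proof. by move=> Mf /C_perm; exact: M_comp. Qed.

Lemma M_subst n (f : nary X n.+1) (g : 'I_n.+1 -> X -> X) :
  C (op f) -> (forall i, M (g i)) -> M (fun x => f (fun i => g i x)).
Proof. by move=> Cf Mg; exact: (clone_comp C_clone Cf Mg). Qed.

Lemma not_sub_Pol (G : set (X -> X)) : ~ C `<=` Pol G ->
  exists n (f : nary X n.+1) (g : 'I_n.+1 -> X -> X),
    [/\ C (op f), forall i, G (g i) & ~ G (fun x => f (fun i => g i x))].
Proof.
move=> nCG; apply: contrapT => nf; apply: nCG => -[n f] Cf g Gg.
by apply: contrapT => nG; apply: nf; exists n, f, g.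
Qed.

(** On the range of half a given injection agrees with a permutation. Since only a
    large set of arguments matters below, arguments outside C can thus be replaced
    by members of C. *)
Lemma realize_injective (q : X -> X) : injective q ->
  exists2 h, M h & forall x, h (half x) = q (half x).
Proof.
move=> qi; have [||||h hb hP] := @perm_conj half (q \o half).
- exact: half_inj.
- exact: inj_comp qi half_inj.
- exact: (half_colarge (g := id)).
- exact: half_colarge.
by exists h => //; exact: C_perm.
Qed.

Lemma realize_constant (u : X -> X) (y c : X) : M u ->
  large (u @^-1` [set y]) -> exists2 h, M h & forall x, h (half x) = c.
Proof.
move=> Mu [e [ei eP]].
have [b Mb bP] := realize_injective ei.
have [s sb sy] := perm1 y c.
exists (s \o (u \o b)) => [|x /=]; first by apply: M_perml => //; exact: M_comp.
by rewrite bP [u _]eP.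
Qed.

(** Let f(g) be constant on a large set, with all fibres of the g i small. Then
    kappa many points of that set can be chosen on which every g i is injective, and
    permutations agreeing with the g i there give a large fibre. *)
Lemma nonB_large_fiber : ~ C `<=` Pol (@monB X) ->
  exists2 u, M u & exists y, large (u @^-1` [set y]).
Proof.
move=> /not_sub_Pol[n [f [g [Cf gB]]]] /existsNP[y /smallE/contrapT ly].
have [|//||q [qR qi]] := @symmetric_choice _
    (fun=> (fun x => f (fun i => g i x)) @^-1` [set y])
    (fun z z' => exists i, g i z = g i z').
- by move=> u v [i e]; exists i.
- move=> _ z l.
  have [||i [_]] := @large_cover _ _ _ setT (fun i => g i @^-1` [set g i z]) l.
  + exact: not_large_finite.
  + by move=> a [_ [i e]]; exists i.
  by move/(large_sub (@subIsetr _ _ _)); apply/smallE; apply: gB.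
have /choice[h hP] : forall i, exists h, M h /\
    forall x, h (half x) = g i (q (half x)).
  move=> i; have [|h Mh hP] := @realize_injective (g i \o q); last by exists h.
  by move=> s t e; apply: contrapT => /qi; apply; exists i.
exists (fun x => f (fun i => h i x)).
  by apply: M_subst => // i; case: (hP i).
exists y; exists half; split=> [|x]; first exact: half_inj.
rewrite -(qR (half x)) /=; congr f; apply/funext => i.
exact: (hP i).2.
Qed.

Definition manyfib (h : X -> X) := large [set y | large (h @^-1` [set y])].

Lemma manyfibE (h : X -> X) : ~ monA h -> manyfib h.
Proof.
move=> /smallE/contrapT; apply: large_sub => y /= /smallE nl.
by apply: contrapT.
Qed.

(** Each large fibre of f(g) is thinned out until every g i is constant or has small
    fibres on it. A constant that occurs is one of the few values with a large fibre
    under g i, so for many of the fibres the same coordinates are constant with the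
    same values. Over these, points are chosen on which the other coordinates are
    injective. The constant coordinates are realized by u and the others by
    permutations. *)
Lemma nonA_manyfib (u : X -> X) (y : X) : M u -> large (u @^-1` [set y]) ->
  ~ C `<=` Pol (@monA X) -> exists2 h, M h & manyfib h.
Proof.
move=> Mu lu /not_sub_Pol[n [f [g [Cf gA]]]] /manyfibE.
set F := fun x => _; pose Y := [set y | large (F @^-1` [set y])].
rewrite -/Y => lY.
have /choice[D DP] : forall y, exists D, Y y -> [/\ D `<=` F @^-1` [set y], large D &
    forall i, (exists c, forall x, D x -> g i x = c) \/
      (forall c, ~ large (D `&` g i @^-1` [set c]))].
  move=> z; have [Yz|nYz] := pselect (Y z); last by exists set0 => /nYz.
  by have [D DP] := @thin_out _ _ _ g _ Yz; exists D.
have /choice[p pP] : forall i, exists p : X -> option X, forall y, Y y ->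
    if p y is Some c then forall x, D y x -> g i x = c
    else forall c, ~ large (D y `&` g i @^-1` [set c]).
  move=> i; suff /choice[p pP] : forall y, exists o : option X, Y y ->
      if o is Some c then forall x, D y x -> g i x = c
      else forall c, ~ large (D y `&` g i @^-1` [set c]) by exists p.
  move=> z; have [Yz|nYz] := pselect (Y z); last by exists None => /nYz.
  have [_ _ /(_ i)[[c cP]|nc]] := DP z Yz; first by exists (Some c).
  by exists None.
have [|Y' [Y'Y lY' Y'c]] := @large_pigeonholes _ _ _ p Y lY.
  move=> i; apply: contra_not (@not_large_finite _ [set @None X] (finite_set1 _)).
  move=> l; have {l} : large ([set None] `|` Some @` [set c | large (g i @^-1` [set c])]).
    apply: large_sub l => o [z Yz <-]; have := pP i z Yz.
    case: (p i z) => [c cP|_]; last by left.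
    right; exists c => //=; have [_ lD _] := DP z Yz.
    by apply: large_sub lD => x /cP.
  move=> /large_setU[//|/large_image l]; exfalso.
  have /smallE := gA i; apply; apply: large_sub l => c /= lc.
  by move/smallE.
have /choice[o oP] := Y'c.
have [e [ei eY']] := lY'.
(* The point chosen for x lies in the fibre over vix x; half fixes the first
   coordinate, so only the second one is used. *)
pose vix x := e (pr1 (pr2 x)).
have Yvix x : Y (vix x) by apply: Y'Y; exact: eY'.
have oD i x : if o i is Some c then forall z, D (vix x) z -> g i z = c
    else forall c, ~ large (D (vix x) `&` g i @^-1` [set c]).
  by have := pP i _ (Yvix x); rewrite (oP i (vix x) (eY' _)); case: (o i).
have [|x||q [qR qi]] := @symmetric_choice _ (fun x => D (vix x))
    (fun z z' => exists i, o i = None /\ g i z = g i z').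
- by move=> a b [i [oi eg]]; exists i.
- by have [] := DP _ (Yvix x).
- move=> x z l.
  have [||i [oi]] := @large_cover _ _ _ [set i | o i = None] (fun i => g i @^-1` [set g i z]) l.
  + by apply: not_large_finite.
  + by move=> a [_ [i [oi eg]]]; exists i.
  move=> l'; have := oD i x; rewrite oi => /(_ (g i z)); apply.
  by apply: large_sub l' => a [[]].
have /choice[h hP] : forall i, exists h, M h /\
    forall x, h (half x) = g i (q (half x)).
  move=> i; case oi : (o i) => [c|].
    have [h Mh hP] := realize_constant c Mu lu; exists h; split=> // x.
    by have := oD i (half x); rewrite oi hP => ->.
  have [|h Mh hP] := @realize_injective (g i \o q); last by exists h.
  by move=> s t eg; apply: contrapT => /qi; apply; exists i.
exists (fun x => f (fun i => h i x)).
  by apply: M_subst => // i; case: (hP i).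
apply: large_sub (large_range ei) => _ [a _ <-].
exists (half \o pair a); split=> [x x' /half_inj/pair_inj[]//|x].
have [+ _ _] := DP _ (Yvix (half (pair a x))).
move=> /(_ _ (qR _)); rewrite /= /F /vix /half pr2_pair pr1_pair => <-.
by congr f; apply/funext => i; exact: (hP i).2.
Qed.

(** * Members whose nonempty fibres are large *)

(** Pre-composing phi with a permutation that scatters the range of v over the large
    fibres of phi gives every map into the values of those fibres. *)
Lemma absorb (phi v g : X -> X) : M phi -> M v -> large (~` range v) ->
  (forall x, large (phi @^-1` [set g (v x)])) -> M (g \o v).
Proof.
move=> Mphi Mv lv lg.
have /choice[E EP] : forall z, exists e : X -> X, large (phi @^-1` [set z]) ->
    injective e /\ forall w, phi (e w) = z.
  move=> z; have [[e eP]|nl] := pselect (large (phi @^-1` [set z])); first by exists e.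
  by exists id => /nl.
have [|||a ab aP] := @extend_perm (range v) (fun y => E (g y) (half y)).
- move=> _ _ [x _ <-] [x' _ <-] e.
  have eg : g (v x) = g (v x').
    by rewrite -((EP _ (lg x)).2 (half (v x))) e (EP _ (lg x')).2.
  by move: e; rewrite -eg => /(EP _ (lg x)).1/half_inj.
- exact: lv.
- apply: (large_half (EP _ (lg pt)).1) => w [_ [x _ <-]] e.
  have eg : g (v x) = g (v pt).
    by rewrite -((EP _ (lg x)).2 (half (v x))) e (EP _ (lg pt)).2.
  by move: e; rewrite eg => /(EP _ (lg pt)).1/pair_inj[/esym/pt'P].
suff -> : g \o v = phi \o a \o v.
  by apply: M_comp => //; exact: M_permr.
by apply/funext => x /=; rewrite aP; [rewrite (EP _ (lg x)).2|exists x].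
Qed.

(** Both functions have large fibres and the same range, so they differ by a
    permutation. *)
Lemma M_of_pr1 h : bigfib h -> M (h \o pr1) -> M h.
Proof.
move=> bh Mh; have [||b bb bP] := @bigfib_conj h (h \o pr1) bh.
- exact: bigfib_pr1.
- by rewrite range_pr1.
suff -> : h = h \o pr1 \o b by apply: M_comp => //; exact: C_perm.
exact/funext.
Qed.

(** Repeated use of absorb: first phi becomes a function whose nonempty fibres are
    all large, then it may be followed by any function with co-large range. *)
Lemma M_bigfib_of_manyfib (phi : X -> X) : M phi -> manyfib phi -> large (~` range phi) ->
  forall h, bigfib h -> large (~` range h) -> M h.
Proof.
pose Y := [set y | large (phi @^-1` [set y])].
move=> Mphi; rewrite /manyfib -/Y => lY lphi.
have Yphi y : Y y -> range phi y by move=> [e [_ /(_ pt) <-]]; exists (e pt).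
have [r [ri rY]] := large_enumX lY.
have rl : large (~` range r).
  by apply: large_sub lphi => y; rewrite rY => ny /Yphi.
have Yr x : Y (r x) by rewrite -rY; exists x.
have post v k : M v -> large (~` range v) -> large (~` range k) -> M (k \o v).
  move=> Mv lv /cover_colarge[t [ti tl kt]].
  have [s sb sP] := perm_conj ri ti rl tl.
  have /choice[w wP] : forall y, exists w, t w = k y.
    by move=> y; have [|w _ e] := kt (k y); [exists y|exists w].
  have -> : k \o v = s \o ((r \o w) \o v).
    by apply/funext => x /=; rewrite sP wP.
  apply: M_comp; first exact: C_perm.
  by apply: (@absorb phi v (r \o w)) => // x; exact: Yr.
have Mr : M (r \o pr1).
  pose g y := if pselect (Y y) then y else r pt.
  have gY y : Y (g y) by rewrite /g; case: pselect => // nYy; exact: Yr.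
  have gid y : Y y -> g y = y by rewrite /g; case: pselect.
  have Mg : M (g \o phi) by apply: (@absorb phi phi g) => // x; exact: gY.
  have gR : range (g \o phi) = Y.
    apply/seteqP; split=> [_ [x _ <-]|y Yy]; first exact: gY.
    have [x _ xy] := Yphi _ Yy; exists x => //=.
    by rewrite xy gid.
  have [|||b bb bP] := @bigfib_conj (r \o pr1) (g \o phi).
  - exact: bigfib_pr1.
  - move=> x; apply: large_sub (gY (phi x)) => y /= e.
    by rewrite e gid.
  - by rewrite range_pr1 gR.
  have -> : r \o pr1 = (g \o phi) \o b by exact/funext.
  by apply: M_comp => //; exact: C_perm.
move=> h bh lh; apply: M_of_pr1 => //.
have [r' rK] := partial_inverse ri.
have -> : h \o pr1 = (h \o r') \o (r \o pr1) by apply/funext => x /=; rewrite rK.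
apply: post => //; first by rewrite range_pr1.
by apply: large_sub lh => y ny [x _ e]; apply: ny; exists (r' x).
Qed.

(** With a permutation a that moves values of phi with large fibres to preimages of
    all values of phi, every nonempty fibre of phi a phi contains a large fibre of
    phi. *)
Lemma M_bigfib_same_range (phi : X -> X) : M phi -> manyfib phi ->
  exists t, [/\ M t, bigfib t & range t = range phi].
Proof.
pose Y := [set y | large (phi @^-1` [set y])].
move=> Mphi; rewrite /manyfib -/Y => -[e [ei eY]].
have [s sP] := partial_section phi.
pose r := e \o half; have ri : injective r by exact: inj_comp ei half_inj.
have [r' rK] := partial_inverse ri.
have rl : large (~` range r) by exact: half_colarge.
have [|||a ab aP] := @extend_perm (r @` range phi) (s \o r').
- move=> _ _ [x [u _ <-] <-] [y [v _ <-] <-] /=; rewrite !rK => e'.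
  by rewrite -(sP u) e' sP.
- by apply: large_sub rl => y ny [x _ xy]; apply: ny; exists x.
- have l := large_setD (eY pt) (@not_large_finite _ [set s (e pt)] (finite_set1 _)).
  apply: large_sub l => z [/= zy nz] [_ [_ [u _ <-] <-]] /=.
  rewrite rK => zs; apply: nz; rewrite -zs; congr s.
  by rewrite -zy -zs sP.
have tE z u : phi z = r (phi u) -> phi (a (phi z)) = phi u.
  by move=> ->; rewrite aP /= ?rK ?sP //; exists (phi u) => //; exists u.
have [w wP] : exists w : X -> X -> X, forall x, injective (w x) /\
    forall z, phi (w x z) = r x.
  suff /choice[w wP] : forall x, exists w : X -> X, injective w /\
    forall z, phi (w z) = r x by exists w.
  by move=> x; have [w [wi wP]] := eY (half x); exists w.
exists (phi \o a \o phi); split.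
- by apply: M_comp => //; exact: M_permr.
- move=> x; exists (w (phi (a (phi x)))); split=> [|z]; first exact: (wP _).1.
  by apply: tE; rewrite (wP _).2.
- apply/seteqP; split=> _ [x _ <-]; first by exists (a (phi x)).
  by exists (w (phi x) x) => //=; apply: tE; rewrite (wP _).2.
Qed.

(** A permutation matching the complements of the ranges reduces this to
    bigfib_conj. *)
Lemma M_bigfib_conj t h : M t -> bigfib t -> bigfib h ->
  ~ large (~` range t) -> ~` range h #= ~` range t -> M h.
Proof.
move=> Mt bt bh nt eht.
have nh : ~ large (~` range h).
  apply: contra_not nt => /card_leTE l; apply/card_leTE.
  by apply: card_le_trans l _; have /card_eqPle[] := eht.
have [i iP] : exists i : X -> X, set_bij (~` range t) (~` range h) i.
  have := card_esym eht.
  move=> /card_bijP[f [f' fK f'K]].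
  pose i x := if pselect ((~` range t) x) is left p then sval (f (SigSub (mem_set p)))
    else x.
  have iE x (p : (~` range t) x) : i x = sval (f (SigSub (mem_set p))).
    rewrite /i; case: pselect => // p'; congr (sval (f _)); exact: val_inj.
  exists i; split.
  - by move=> x p; rewrite (iE _ p); apply: set_mem; exact: valP.
  - move=> x y /set_mem p /set_mem q; rewrite (iE _ p) (iE _ q).
    by move=> /val_inj/(can_inj fK) e; have := congr1 sval e.
  - move=> y q; pose z := f' (SigSub (mem_set q)).
    have p : (~` range t) (sval z) by apply: set_mem; exact: valP.
    exists (sval z) => //; rewrite (iE _ p).
    have -> : SigSub (mem_set p) = z by exact: val_inj.
    by rewrite f'K.
have [ii1 ii2 ii3] := iP.
have [|||a ab aP] := @extend_perm (~` range t) i.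
- by move=> x y tx ty; apply: ii2; exact: mem_set.
- exact: large_setC.
- by apply: large_setC; apply: contra_not nh; apply: large_sub => _ [x tx <-]; exact: ii1.
have aR : range (a \o t) = range h.
  apply/seteqP; split=> [_ [x _ <-]|y hy].
    apply: contrapT => /ii3[z tz] /=; rewrite -aP // => /(bij_inj ab) e.
    by apply: tz; exists x.
  have [x xy] := bij_surj ab y; have [[z _ zx]|tx] := pselect (range t x).
    by exists z => //=; rewrite zx.
  by have := ii1 x tx; rewrite -(aP x tx) xy.
have [||b bb bP] := @bigfib_conj h (a \o t) bh; last 2 first.
- by rewrite aR.
- have -> : h = a \o t \o b by exact/funext.
  by apply: M_permr => //; exact: M_perml.
by move=> x; apply: large_sub (bt x) => y /= ->.
Qed.

Hypothesis C_not_G : forall L : set X, L !=set0 -> ~ C `<=` Pol (monG L).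

Lemma retraction (A : set X) (a : X) : A a ->
  exists r : X -> X, (forall x, A (r x)) /\ forall x, A x -> r x = x.
Proof.
move=> Aa; exists (fun x => if pselect (A x) then x else a).
by split=> x; case: pselect.
Qed.

(** Take a least complement L of a range. If L is nonempty, there are f in C and
    functions g i in the monoid of L such that f(g) is not in it: for some A of size
    L, f(g) maps the complement of A onto all but fewer than L points. Each g i
    misses at least L points there, so it can be extended by further arguments to a
    function k i with large fibres that misses exactly as many points as L has. The
    k i lie in C, and f(k) misses fewer points than L has. *)
Lemma M_bigfib_surj t : M t -> bigfib t -> ~ large (~` range t) ->
  forall h, bigfib h -> range h = setT -> M h.
Proof.
move=> Mt bt nt.
pose F := [set L | exists s, [/\ M s, bigfib s, ~` range s = L & ~ large L]].
have [|L [[s [Ms bs sL nL]] Lmin]] := @min_card F; first by exists (~` range t), t.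
have [L0|/set0P Lne] := eqVneq L set0.
  move=> h bh hT; apply: (M_bigfib_conj Ms bs bh); first by rewrite sL.
  by rewrite sL L0 hT setCT.
exfalso; have /not_sub_Pol[n [f [g [Cf gG]]]] := C_not_G Lne.
move=> /existsNP[A] /not_implyP[AL nLF].
have LB i : L #<= ~` (g i @` (~` A)) by apply: gG.
have nA : ~ large A.
  apply: contra_not nL => /card_leTE l; apply/card_leTE.
  by apply: card_le_trans l _; have /card_eqPle[] := AL.
have [a0 Aa0] : (~` A) !=set0.
  by have [e [_ eA]] := large_setC nA; exists (e pt).
have [r [rA rid]] := retraction Aa0.
have /choice[B BP] : forall i, exists B, B `<=` ~` (g i @` (~` A)) /\ B #= L.
  move=> i; have /card_subP[B sB BL] := LB i.
  by exists B.
have nB i : ~ large (B i).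
  apply: contra_not nL => /card_leTE l; apply/card_leTE.
  by apply: card_le_trans l _; have /card_eqPle[] := (BP i).2.
have /choice[q qP] : forall i, exists q : X -> X,
    (forall x, (~` B i) (q x)) /\ forall x, (~` B i) x -> q x = x.
  move=> i; have [e [_ eB]] := large_setC (nB i).
  exact: (retraction (eB pt)).
(* The part over pt carries g i off A, the rest covers everything outside B i. *)
pose k i y := if pselect (pr1 y = pt) then g i (r (pr2 y)) else q i (pr2 y).
have kpt i y : k i (pair pt y) = g i (r y).
  by rewrite /k pr1_pair pr2_pair; case: pselect.
have kpt' i y : k i (pair pt' y) = q i y.
  by rewrite /k pr1_pair pr2_pair if_fails //; exact: pt'P.
have kR i : ~` range (k i \o pr1) = B i.
  rewrite range_pr1 -[RHS]setCK; congr (~` _); apply/seteqP; split=> [_ [y _ <-]|b Bb].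
    rewrite /k; case: pselect => ?; last exact: (qP i).1.
    by move=> /(BP i).1; apply; exists (r (pr2 y)) => //; exact: rA.
  by exists (pair pt' b) => //; rewrite kpt' (qP i).2.
have Mk i : M (k i \o pr1).
  apply: (M_bigfib_conj Ms bs); first exact: bigfib_pr1.
    by rewrite sL.
  by rewrite kR sL; exact: (BP i).2.
pose F' y := f (fun i => k i y).
have MF : M (F' \o pr1) by exact: (M_subst Cf Mk).
have sub : ~` range (F' \o pr1) `<=` ~` ((fun x => f (fun i => g i x)) @` (~` A)).
  rewrite range_pr1; apply: subsetC => _ [x nAx <-]; exists (pair pt x) => //.
  by rewrite /F'; congr f; apply/funext => i; rewrite kpt rid.
have nF : ~ large (~` range (F' \o pr1)).
  move=> /(large_sub sub)/card_leTE l; apply: nLF.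
  by apply: card_le_trans l; exact: card_leT.
apply: nLF; apply: card_le_trans (subset_card_le sub).
by apply: Lmin; exists (F' \o pr1); split=> //; exact: bigfib_pr1.
Qed.

Section Transfer.
Hypothesis M_surj : forall h, bigfib h -> range h = setT -> M h.

Lemma M_pr1 : M pr1.
Proof.
apply: M_surj => [x|]; first exact: (@bigfib_pr1 id).
by apply/seteqP; split=> // x _; exists (pair x x); rewrite ?pr1_pair.
Qed.

Lemma M_onto (k : X -> X) : (forall y, exists x, k x = y) -> M (k \o pr1).
Proof.
move=> kS; apply: M_surj; first exact: bigfib_pr1.
by rewrite range_pr1; apply/seteqP; split=> // y _; have [x] := kS y; exists x.
Qed.

(** An almost surjective g i is made surjective by adding, for each of its few
    missing values, one tuple with this value at coordinate i; these tuples
    contribute few values of f. Repeating every tuple kappa times makes the fibres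
    large. *)
Lemma fill_range n (f : nary X n.+1) (g : 'I_n.+1 -> X -> X) : C (op f) ->
  (forall i, almost_surjective (g i) \/ (exists2 c, M (fun=> c) & forall x, g i x = c)) ->
  let F := fun x => f (fun i => g i x) in
  exists t, [/\ M t, range F `<=` range t & ~ large (range t `\` range F)].
Proof.
move=> Cf gP F; have [idx idxP] := idx_exists n.
(* The part over pt carries g; elsewhere idx selects the coordinate that receives
   the missing value pr2 y. *)
pose k i y := if pselect (pr1 y = pt) then g i (pr2 y) else
  if pselect [/\ idx (pr1 y) = i, almost_surjective (g i) & ~ range (g i) (pr2 y)]
  then pr2 y else g i pt.
have Mk i : M (k i \o pr1).
  have [gs|nas] := pselect (almost_surjective (g i)).
    apply: M_onto => b; have [[x _ xb]|nb] := pselect (range (g i) b).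
      by exists (pair pt x); rewrite /k pr1_pair pr2_pair; case: pselect.
    have [a na ai] := idxP i; exists (pair a b); rewrite /k pr1_pair pr2_pair.
    by case: pselect => // ?; case: pselect => // -[].
  have [//|[c Mc gc]] := gP i; suff -> : k i \o pr1 = fun=> c by [].
  apply/funext => x; rewrite /= /k !gc; case: pselect => // ?.
  by case: pselect => // -[].
exists (fun x => f (fun i => (k i \o pr1) x)); split; first exact: M_subst.
  move=> _ [x _ <-]; exists (pair (pair pt x) pt) => //; rewrite /F; congr f.
  by apply/funext => i /=; rewrite pr1_pair /k pr1_pair pr2_pair; case: pselect.
move=> l.
pose S j := [set f (fun i => if i == j then b else g i pt) | b in ~` range (g j)].
have [||j [gj lj]] := @large_cover _ _ _ [set j | almost_surjective (g j)] S l.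
- by apply: not_large_finite.
- move=> _ [[x _ <-] nF] /=; set y := pr1 x.
  have nFpt b : f (fun i => k i y) <> F b.
    by move=> e; apply: nF; exists b.
  have yn : pr1 y <> pt.
    move=> e; apply: (nFpt (pr2 y)); congr f; apply/funext => i.
    by rewrite /k; case: pselect.
  have kj i : k i y = if pselect [/\ idx (pr1 y) = i, almost_surjective (g i) &
      ~ range (g i) (pr2 y)] then pr2 y else g i pt.
    by rewrite /k; case: pselect.
  pose j := idx (pr1 y).
  have [[gj nj]|nj] := pselect (almost_surjective (g j) /\ ~ range (g j) (pr2 y)).
    exists j; split=> //; exists (pr2 y) => //; congr f; apply/funext => i.
    rewrite kj; case: eqP => [->|ij]; case: pselect => //.
      by case; split.
    by case=> e; case: ij.
  exfalso; apply: (nFpt pt); congr f; apply/funext => i; rewrite kj.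
  by case: pselect => // -[ij gi ni]; case: nj; rewrite /j ij.
have /smallE := gj; apply.
apply: (@large_image _ _ (fun b => f (fun i => if i == j then b else g i pt))).
by apply: large_sub lj => z [].
Qed.

Hypothesis C_not_E : ~ C `<=` Pol (@monE X).
Hypothesis C_not_F : ~ C `<=` Pol (@monF X).
Hypothesis C_wide : exists n (f : nary X n.+1), C (op f) /\
  forall i, exists c, large (f @` [set r | r i = c]).

Lemma colarge_fill (F t : X -> X) : ~ almost_surjective F ->
  ~ large (range t `\` range F) -> large (~` range t).
Proof.
move=> /smallE/contrapT lF nt; apply: large_sub (large_setD lF nt) => y [ny nty] ty.
by apply: nty.
Qed.

(** Suppose not. Then every unary member is almost surjective or has a small range.
    The witness for E gives the second kind, hence all constants, and the one for F
    gives all two-valued functions with large fibres. Let f be an operation that is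
    not almost unary. If f takes few values on some hyperplane r i = d, combine the
    tuples of this hyperplane, which make all coordinates but i surjective, with
    half of a large family of tuples with r i = c. Otherwise every hyperplane
    contains many values of f; choose one tuple from each with all chosen values
    distinct, leaving out many values. In both cases the coordinates are in C, and f
    has on the chosen tuples a range that is large and co-large. *)
Lemma M_manyfib_colarge : exists phi, [/\ M phi, manyfib phi & large (~` range phi)].
Proof.
apply: contrapT => nphi.
have small_range v : M v -> large (~` range v) -> ~ large (range v).
  move=> Mv lv l; apply: nphi; exists (v \o pr1).
  rewrite range_pr1; split=> //; first exact: M_comp Mv M_pr1.
  by apply: large_sub l => _ [x _ <-]; apply: large_fiber_pr1.
have Mconst c : M (fun=> c).
  have [n [f [g [Cf gE nE]]]] := not_sub_Pol C_not_E.
  have [|v [Mv _ vF]] := @fill_range _ _ g Cf; first by move=> i; left; exact: gE.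
  have lv := colarge_fill nE vF.
  have [s sb sc] := perm1 (v (pr1 pt)) c.
  have Mv1 : M (v \o pr1) by exact: M_comp Mv M_pr1.
  have Mc : M ((fun=> v (pr1 pt)) \o (v \o pr1)).
    apply: (@absorb (v \o pr1)) => //; first by rewrite range_pr1.
    by move=> _; exact: bigfib_pr1.
  have -> : (fun=> c) = s \o ((fun=> v (pr1 pt)) \o (v \o pr1)).
    by apply/funext => x /=.
  exact: M_perml.
have Mtwo (c d : X) k : c <> d -> (forall x, k x = c \/ k x = d) ->
    large (k @^-1` [set c]) -> large (k @^-1` [set d]) -> M k.
  have [n [f [g [Cf gF nF]]]] := not_sub_Pol C_not_F.
  have [|v [Mv Fv vF]] := @fill_range _ _ g Cf.
    by move=> i; have [?|[z zP]] := gF i; [left|right; exists z].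
  have lv : large (~` range v) by apply: colarge_fill vF => e; apply: nF; left.
  have [x [y nxy]] : exists x y, v x <> v y.
    apply: contrapT => nv; apply: nF; right; exists (v pt) => x.
    have [z _ <-] := Fv _ (ex_intro2 _ _ x I erefl).
    by apply: contrapT => nz; apply: nv; exists z, pt.
  pose g' z := if pselect (z = v y) then v y else v x.
  have g'x : g' (v x) = v x by rewrite /g'; case: pselect.
  have g'y : g' (v y) = v y by rewrite /g'; case: pselect.
  have g'xy z : g' z = v x \/ g' z = v y by rewrite /g'; case: pselect; [right|left].
  have Mv1 : M (v \o pr1) by exact: M_comp Mv M_pr1.
  have Mw : M (g' \o (v \o pr1)).
    apply: (@absorb (v \o pr1)) => //; first by rewrite range_pr1.
    move=> z; have [->|->] := g'xy ((v \o pr1) z).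
      by have := @bigfib_pr1 v (pair x x); rewrite /= pr1_pair.
    by have := @bigfib_pr1 v (pair y y); rewrite /= pr1_pair.
  move=> ncd kcd lc ld; have [s sb [sx sy]] := perm2 nxy ncd.
  have bk : bigfib k by move=> z; have [->|->] := kcd z.
  have [||b bb bP] := @bigfib_conj k (s \o g' \o v \o pr1) bk.
  - exact: (@bigfib_pr1 (s \o g' \o v)).
  - rewrite range_pr1; apply/seteqP; split=> _ [z _ <-].
      have [->|->] := kcd z; first by exists x => //=; rewrite g'x.
      by exists y => //=; rewrite g'y.
    have [[ec cP] [ed dP]] := (lc, ld).
    rewrite /=; have [->|->] := g'xy (v z); rewrite ?sx ?sy.
      by exists (ec pt); [|exact: cP.2].
    by exists (ed pt); [|exact: dP.2].
  have -> : k = s \o (g' \o (v \o pr1)) \o b by exact/funext.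
  by apply: M_permr => //; exact: M_perml.
have [n [f [Cf /choice[c cP]]]] := C_wide.
pose R i d := f @` [set r | r i = d].
have [[i [d nRd]]|lR] := pselect (exists i d, ~ large (R i d)).
  have ncd : c i <> d by move=> e; apply: nRd; rewrite -e; exact: cP.
  have [r [ri rc]] := large_lift (cP i).
  pose h j x := if pselect (pr1 x = pt) then r (half (pr2 x)) j
    else if j == i then d else pr1 (pr2 x).
  have hpt j x : h j (pair pt x) = r (half x) j.
    by rewrite /h pr1_pair pr2_pair if_holds.
  have hpt' j x : h j (pair pt' x) = if j == i then d else pr1 x.
    by rewrite /h pr1_pair pr2_pair if_fails //; exact: pt'P.
  have Mh j : M (h j).
    have [->|/eqP ji] := eqVneq j i.
      apply: (@Mtwo (c i) d) => //.
      - move=> x; rewrite /h eqxx; case: pselect => ?; last by right.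
        by left; exact: rc.
      - exists half; split=> [|x]; first exact: half_inj.
        by rewrite /= hpt; exact: rc.
      - exists (pair pt'); split=> [x y /pair_inj[]//|x].
        by rewrite /= hpt' eqxx.
    have fib y : large (h j @^-1` [set y]).
      exists (fun w => pair pt' (pair y w)); split=> [w w' /pair_inj[_ /pair_inj[]]//|w].
      by rewrite /= hpt' (introF eqP ji) pr1_pair.
    apply: M_surj => [x|]; first exact: fib.
    by apply/seteqP; split=> // y _; have [e [_ eP]] := fib y;
      exists (e pt); last exact: eP.
  have Mt : M (fun x => f (fun j => h j x)) by exact: M_subst.
  apply: (small_range _ Mt).
    have l : large (~` range ((f \o r) \o half)) by exact: half_colarge.
    apply: large_sub (large_setD l nRd) => y [ny nyR] [x _ xy].
    have [x1|x1] := pselect (pr1 x = pt).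
      apply: ny; exists (pr2 x) => //; rewrite -xy /=; congr f; apply/funext => j.
      by rewrite -hpt -x1 pair_pr.
    apply: nyR; rewrite -xy; eexists; last reflexivity.
    by rewrite /= /h eqxx; case: pselect.
  exists (fun x => f (r (half x))); split=> [x y /ri/half_inj//|x].
  by exists (pair pt x) => //; congr f; apply/funext => j; rewrite hpt.
have [idx idxP] := idx_exists n.
have [|x||g [gR gi]] := @symmetric_choice _
  (fun x => R (idx (pr1 x)) (pr1 (pr2 x))) eq.
- by move=> u v ->.
- by apply: contrapT => nl; apply: lR; exists (idx (pr1 x)), (pr1 (pr2 x)).
- move=> x u /(@large_sub _ _ [set u]) l; apply: (not_large_finite (finite_set1 u)).
  by apply: l => y [].
have {}gi : injective g by move=> s t e; apply: contrapT => /gi.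
have /choice[q qP] : forall x, exists r, r (idx (pr1 x)) = pr1 (pr2 x) /\ f r = g x.
  by move=> x; have [r rx e] := gR x; exists r.
pose W y := pair (pr1 y) (pair (pr2 y) pt).
have Wi : injective W.
  move=> y z /pair_inj[e1 /pair_inj[e2 _]].
  by rewrite -(pair_pr y) e1 e2 pair_pr.
pose h i x := q (W x) i.
have Mh i : M (h i \o pr1).
  apply: M_onto => d; have [a _ ai] := idxP i; exists (pair a d).
  have := (qP (W (pair a d))).1.
  by rewrite /h /W !pr1_pair !pr2_pair !pr1_pair ai.
have Mt : M ((g \o W) \o pr1).
  have -> : (g \o W) \o pr1 = fun x => f (fun i => (h i \o pr1) x).
    by apply/funext => x /=; rewrite -(qP _).2.
  exact: M_subst.
apply: (small_range _ Mt); rewrite range_pr1.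
  exists (fun z => g (pair z (pair pt pt'))); split=> [y z /gi/pair_inj[]//|z].
  by move=> [y _ /gi/pair_inj[_ /pair_inj[_ /esym/pt'P]]].
by apply: large_range; exact: inj_comp gi Wi.
Qed.

End Transfer.

Hypothesis C_not_A : ~ C `<=` Pol (@monA X).
Hypothesis C_not_B : ~ C `<=` Pol (@monB X).
Hypothesis C_not_E : ~ C `<=` Pol (@monE X).
Hypothesis C_not_F : ~ C `<=` Pol (@monF X).
Hypothesis C_wide : exists n (f : nary X n.+1), C (op f) /\
  forall i, exists c, large (f @` [set r | r i = c]).

Lemma M_bigfib_colarge h : bigfib h -> large (~` range h) -> M h.
Proof.
suff [phi [Mphi mphi lphi]] :
    exists phi, [/\ M phi, manyfib phi & large (~` range phi)].
  exact: M_bigfib_of_manyfib lphi h.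
have [u Mu [y lu]] := nonB_large_fiber C_not_B.
have [phi Mphi mphi] := nonA_manyfib Mu lu C_not_A.
have [l|nl] := pselect (large (~` range phi)); first by exists phi.
have [t [Mt bt tR]] := M_bigfib_same_range Mphi mphi.
by apply: M_manyfib_colarge => //; apply: (M_bigfib_surj Mt bt); rewrite tR.
Qed.

(** Failure of the monoid of X itself starts the descent of M_bigfib_surj. *)
Lemma M_bigfib h : bigfib h -> M h.
Proof.
have [t [Mt bt nt]] : exists t, [/\ M t, bigfib t & ~ large (~` range t)].
  have [|n [f [g [Cf gG]]]] := not_sub_Pol (C_not_G (L := setT) _).
    by exists pt.
  move=> /existsNP[A] /not_implyP[AL nLF].
  have nl : ~ large (~` ((fun x => f (fun i => g i x)) @` (~` A))) by move=> /card_leTE.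
  have [a0 Aa0] : (~` A) !=set0.
    apply: contrapT => n0; apply: nl; exists id; split=> // x [y nAy].
    by case: n0; exists y.
  have [r [rA rid]] := retraction Aa0.
  have rR (k : X -> X) : range ((k \o r) \o pr1) = k @` (~` A).
    rewrite range_pr1; apply/seteqP; split=> [_ [x _ <-]|_ [x nAx <-]].
      by exists (r x) => //; exact: rA.
    by exists x => //=; rewrite rid.
  exists (((fun x => f (fun i => g i x)) \o r) \o pr1); split.
  - apply: (M_subst (g := fun i => (g i \o r) \o pr1)) => // i.
    apply: M_bigfib_colarge; first exact: bigfib_pr1.
    by rewrite rR; apply/card_leTE; exact: gG.
  - exact: bigfib_pr1.
  - by rewrite rR.
have M_surj := M_bigfib_surj Mt bt nt.
move=> bh; apply: M_of_pr1 => //.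
have -> : h \o pr1 = pr1 \o ((fun x => pair (h x) pt) \o pr1).
  by apply/funext => x /=; rewrite pr1_pair.
apply: M_comp; first exact: M_pr1.
apply: M_bigfib_colarge; first exact: bigfib_pr1.
rewrite range_pr1; exists (fun z => pair z pt'); split=> [y z /pair_inj[]//|z].
by move=> [x _ /pair_inj[_ /esym/pt'P]].
Qed.

(** * Splitting fibres *)

(** The tuples p i j serve to make the fibres of the other coordinates large without
    adding preimages of the values f (q k). If fixing some coordinate i1 at a value
    that occurs in the family determines f, start from a family with constant
    coordinate i1 instead and put this value there. Otherwise suitable p i j exist
    one at a time, and the family is thinned out until their values avoid it. *)
Lemma padded_family n (f : nary X n.+1) :
    (forall i, exists c, large (f @` [set r | r i = c])) ->
  exists i0 c (q : X -> 'I_n.+1 -> X) (p : 'I_n.+1 -> X -> 'I_n.+1 -> X),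
    [/\ injective (f \o q), forall j, q j i0 = c,
        forall i j, i <> i0 -> p i j i = q j i & forall i j k, f (p i j) <> f (q k)].
Proof.
move=> /choice[c cP]; have [r [ri rc]] := large_lift (cP ord0).
have [[i1 [k [ni1 frozen]]]|nfr] := pselect (exists i1 k, i1 <> ord0 /\
    forall s, s i1 = r k i1 -> f s = f (r k)).
  have [s [si sP]] : exists s : X -> 'I_n.+1 -> X, injective (f \o s) /\
      forall x, s x i1 = c i1 /\ f (s x) <> f (r k).
    apply: (@large_lift _ _ f [set s | s i1 = c i1 /\ f s <> f (r k)]).
    have nl := @not_large_finite _ [set f (r k)] (finite_set1 _).
    apply: large_sub (large_setD (cP i1) nl) => _ [[s sc <-] ns].
    by exists s.
  pose p (i : 'I_n.+1) j i' := if i' == i1 then r k i1 else s j i'.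
  have pP i j : f (p i j) = f (r k) by apply: frozen; rewrite /p eqxx.
  exists i1, (c i1), s, p; split=> //.
  - by move=> j; case: (sP j).
  - by move=> i j ii1; rewrite /p; case: eqP.
  - by move=> i j k'; rewrite pP => /esym; case: (sP k').
have /choice[p0 p0P] : forall i, exists p0 : X -> 'I_n.+1 -> X, forall k,
    (i <> ord0 -> p0 k i = r k i) /\ f (p0 k) <> f (r k).
  move=> i; suff /choice[p0 p0P] : forall k, exists s : 'I_n.+1 -> X,
      (i <> ord0 -> s i = r k i) /\ f s <> f (r k) by exists p0.
  move=> k; have [->|/eqP i0] := eqVneq i ord0.
    by have [k' k'k] := another k; exists (r k'); split=> // /ri.
  apply: contrapT => ns; apply: nfr; exists i, k; split=> // s si.
  by apply: contrapT => nf; apply: ns; exists s.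
pose phi i k := f (p0 i k).
have [D [_ lD Dphi]] := thin_out phi large_setT.
(* Conflicts count only inside D: there a constant phi i never takes the value
   f (r z), since phi i z differs from it. *)
have [|//||g [gD gi]] := @symmetric_choice _ (fun=> D)
    (fun z z' => [/\ D z, D z' & z = z' \/
       exists i, f (r z') = phi i z \/ f (r z) = phi i z']).
- move=> u v [Du Dv [->|[i [e|e]]]]; split=> //; first by left.
    by right; exists i; right.
  by right; exists i; left.
- move=> _ z l.
  have /large_setU[/(not_large_finite (finite_set1 _))//|] :
      large ([set z] `|` [set z' | [/\ D z, D z' &
        exists i, f (r z') = phi i z \/ f (r z) = phi i z']]).
    apply: large_sub l => z' [_ [Dz Dz' [->|e]]]; [by left|by right].
  move=> l'.
  have [||i [_ li]] := @large_cover _ _ _ setT (fun i => [set z' | [/\ D z, D z' &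
      f (r z') = phi i z \/ f (r z) = phi i z']]) l'.
  + exact: not_large_finite.
  + by move=> z' [Dz Dz' [i e]]; exists i; split.
  have /large_setU[l1|l2] : large ([set z' | f (r z') = phi i z] `|`
      [set z' | [/\ D z, D z' & f (r z) = phi i z']]).
    by apply: large_sub li => z' [_ [Dz Dz' [e|e]]]; [left|right].
  + case: l1 => e [ei eP]; have [y yx] := another pt; apply: yx; apply: ei; apply: ri.
    by rewrite /= !eP.
  + have [[u uP]|nu] := Dphi i; last first.
      apply: (nu (f (r z))); apply: large_sub l2 => z' [_ Dz' ->].
      by split.
    case: l2 => e [_ /(_ pt)[Dz De]]; rewrite (uP _ De) -(uP _ Dz) => e'.
    exact: (p0P i z).2 (esym e').
have gI : injective g.
  by move=> s t e; apply: contrapT => /gi; apply; split=> //; left.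
exists ord0, (c ord0), (fun j => r (g j)), (fun i j => p0 i (g j)); split.
- by move=> s t /= /ri/gI.
- by move=> j; exact: rc.
- by move=> i j ni; apply: (p0P i (g j)).1.
- move=> i j k e; have [jk|/gi] := pselect (j = k).
    by apply: (p0P i (g j)).2; rewrite e jk.
  by apply; split=> //; right; exists i; left.
Qed.

(** The tuple q j occurs once and each p i j occurs kappa many times, so the
    coordinates have large fibres although the value of f at q j is taken only once. *)
Lemma M_separating : exists t, [/\ M t,
    forall b b', t (pair pt b) = t (pair pt b') -> b = b',
    forall b x, pr1 x <> pt -> t x <> t (pair pt b) & large (~` range t)].
Proof.
have [n [f [Cf fw]]] := C_wide.
have [i0 [c [q [p [qi qc pq pf]]]]] := padded_family fw.
have [idx idxP] := idx_exists n.
pose h i x := if pselect (pr1 x = pt) then q (half (pr2 x)) i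
  else p (idx (pr1 x)) (pr1 (pr2 x)) i.
have hpt i b : h i (pair pt b) = q (half b) i.
  by rewrite /h pr1_pair pr2_pair if_holds.
have hnpt i x : pr1 x <> pt -> h i x = p (idx (pr1 x)) (pr1 (pr2 x)) i.
  by move=> ?; rewrite /h if_fails.
have Mh i : M (h i).
  apply: M_bigfib => x; have [x1|x1] := pselect (pr1 x = pt).
    have [->|/eqP ni] := eqVneq i i0.
      exists half; split=> [|w]; first exact: half_inj.
      by rewrite /= hpt -(pair_pr x) x1 hpt !qc.
    have [a na ai] := idxP i.
    exists (fun w => pair a (pair (half (pr2 x)) w)); split=> [w w'|w].
      by move=> /pair_inj[_ /pair_inj[]].
    rewrite /= hnpt pr1_pair // pr2_pair pr1_pair ai pq //.
    by rewrite -{2}(pair_pr x) x1 hpt.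
  exists (fun w => pair (pr1 x) (pair (pr1 (pr2 x)) w)); split=> [w w'|w].
    by move=> /pair_inj[_ /pair_inj[]].
  by rewrite /= hnpt pr1_pair // pr2_pair pr1_pair hnpt.
pose t x := f (fun i => h i x).
have tpt b : t (pair pt b) = f (q (half b)).
  by rewrite /t; congr f; apply/funext => i; exact: hpt.
have tn x : pr1 x <> pt -> t x = f (p (idx (pr1 x)) (pr1 (pr2 x))).
  by move=> nx; rewrite /t; congr f; apply/funext => i; exact: hnpt.
exists t; split.
- exact: M_subst.
- by move=> b b'; rewrite !tpt => /qi/half_inj.
- by move=> b x nx; rewrite tpt tn.
- apply: (large_half qi) => w [x _]; have [x1|x1] := pselect (pr1 x = pt).
    by rewrite -(pair_pr x) x1 tpt => /qi/pair_inj[/esym/pt'P].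
  by rewrite tn // => /pf.
Qed.

(** Post-composing t with a function whose fibres are padded off the range of t
    leaves the values on the part where t is injective unconstrained. *)
Lemma M_large_fiber h z : large (h @^-1` [set z]) -> M h.
Proof.
move=> lz; have [t [Mt ti tn [e [ei eP]]]] := M_separating.
have [|||a ab aP] := @extend_perm (~` (h @^-1` [set z])) (fun x => pair pt (half x)).
- by move=> x y _ _ /pair_inj[_ /half_inj].
- by rewrite setCK.
- exists (pair pt'); split=> [x y /pair_inj[]//|x].
  by move=> [y _ /pair_inj[/esym/pt'P]].
have th x y : t (a x) = t (a y) -> h x = h y.
  move=> txy.
  have aux u v : t (a u) = t (a v) -> h u <> z -> u = v.
    move=> e1 hu; rewrite (aP u hu) in e1.
    have [v1|/tn nv] := pselect (pr1 (a v) = pt); last by case: (nv (half u)).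
    rewrite -(pair_pr (a v)) v1 in e1; apply: (bij_inj ab).
    by rewrite (aP u hu) -(pair_pr (a v)) v1 (ti _ _ e1).
  have [hx|hx] := pselect (h x = z); last by rewrite (aux x y).
  have [hy|hy] := pselect (h y = z); first by rewrite hx hy.
  by rewrite (aux y x).
have [e' eK] := partial_inverse ei.
have /choice[k kP] : forall y, exists u, [/\ exists x, u = h x,
    forall x, t (a x) = y -> u = h x & forall w, e w = y -> u = h (pr1 w)].
  move=> y; have [[x xy]|nx] := pselect (exists x, t (a x) = y).
    exists (h x); split; [by exists x|by move=> x'; rewrite -xy => /th|].
    by move=> w wy; case: (eP w); exists (a x) => //; rewrite wy.
  exists (h (pr1 (e' y))); split; first by exists (pr1 (e' y)).
    by move=> x xy; case: nx; exists x.
  by move=> w <-; rewrite eK.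
have -> : h = k \o (t \o a).
  by apply/funext => x /=; have [_ /(_ x erefl)] := kP (t (a x)).
apply: M_comp; last exact: M_permr.
apply: M_bigfib => y; have [[x ->] _ _] := kP y.
exists (fun w => e (pair x w)); split=> [w w' /ei/pair_inj[]//|w].
by have [_ _ /(_ _ erefl)] := kP (e (pair x w)); rewrite pr1_pair.
Qed.

(** The arguments are split into one part for each coordinate i; on that part the
    i-th coordinate is constant and f takes many values. Every coordinate thus has a
    large fibre, and the values can be chosen distinct. *)
Lemma M_injective : exists j, [/\ M j, injective j & large (~` range j)].
Proof.
have [n [f [Cf /choice[c cP]]]] := C_wide.
have [idx idxP] := idx_exists n.
have [|x||g [gR gi]] := @symmetric_choice _
  (fun x => f @` [set r | r (idx (pr1 x)) = c (idx (pr1 x))]) eq.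
- by move=> u v ->.
- exact: cP.
- move=> x u /(@large_sub _ _ [set u]) l; apply: (not_large_finite (finite_set1 u)).
  by apply: l => y [].
have {}gi : injective g by move=> s t e; apply: contrapT => /gi.
have /choice[q qP] : forall x, exists r,
    r (idx (pr1 x)) = c (idx (pr1 x)) /\ f r = g x.
  by move=> x; have [r rx e] := gR x; exists r.
pose W x := pair (pr1 x) (half (pr2 x)).
have Wi : injective W.
  by move=> y z /pair_inj[e1 /half_inj e2]; rewrite -(pair_pr y) e1 e2 pair_pr.
have gWE x : (g \o W) x = f (fun i => q (W x) i) by exact: esym (qP (W x)).2.
exists (g \o W); split.
- have -> : g \o W = fun x => f (fun i => q (W x) i) by exact/funext.
  apply: (M_subst (g := fun i x => q (W x) i)) => // i.
  have [a _ ai] := idxP i; apply: (@M_large_fiber _ (c i)).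
  exists (pair a); split=> [w w' /pair_inj[]//|w].
  by have := (qP (W (pair a w))).1; rewrite /= /W !pr1_pair ai.
- exact: inj_comp gi Wi.
- exists (fun z => g (pair z (pair pt' pt))); split=> [y z /gi/pair_inj[]//|z].
  by move=> [y _ /gi/pair_inj[_ /pair_inj[/esym/pt'P]]].
Qed.

Lemma M_full h : M h.
Proof.
have [j [Mj ji jl]] := M_injective.
have hi : injective (fun x => pair (h x) (half x)) by move=> x y /pair_inj[_ /half_inj].
have [|s sb sP] := @perm_conj j (fun x => pair (h x) (half x)) ji hi jl.
  exists (fun w => pair pt (pair pt' w)); split=> [x y /pair_inj[_ /pair_inj[]]//|w].
  by move=> [x _ /pair_inj[_ /pair_inj[/esym/pt'P]]].
have -> : h = pr1 \o (s \o j) by apply/funext => x /=; rewrite sP pr1_pair.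
apply: M_comp; last exact: M_perml.
by apply: M_bigfib => x; exact: (@bigfib_pr1 id).
Qed.
End CloneOverPermutations.

(** * The listed monoids *)

Lemma Pol_clone (G : set (X -> X)) : is_clone (Pol G).
Proof.
split=> [n i g Gg|n m f g Pf Pg k Gk]; first exact: Gg.
by apply: (Pf (fun i x => g i (fun j => k j x))) => i; exact: Pg.
Qed.

Lemma Pol_unary (G : set (X -> X)) f : is_submonoid G -> Pol G (unary_op f) <-> G f.
Proof.
move=> [Gid Gcomp]; split=> [Pf|Gf g Gg]; first exact: (Pf (fun=> id)).
exact: (Gcomp f (g ord0)).
Qed.

Definition bin (B : X -> X -> X) : nary X 2 := fun r => B (r ord0) (r ord_max).

Lemma Pol_bin (G : set (X -> X)) B : Pol G (op (bin B)) <->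
  forall g1 g2, G g1 -> G g2 -> G (fun x => B (g1 x) (g2 x)).
Proof.
split=> [PB g1 g2 G1 G2|GB g Gg]; last exact: GB.
by apply: (PB (fun i => if i == ord0 then g1 else g2)) => i; case: ifP.
Qed.

Lemma large_card_le (A B : set X) : large B -> A #<= B.
Proof. by move=> /card_leTE h; apply: card_le_trans h; exact: card_leT. Qed.

Lemma monA_submonoid : is_submonoid (@monA X).
Proof.
split.
  apply/smallE => l; apply: (@not_large_finite X set0); first exact: finite_set0.
  apply: large_sub l => y /= ns; apply: ns; apply/smallE.
  by apply: not_large_finite; exact: finite_set1.
move=> f g /smallE Af /smallE Ag; apply/smallE => l.
have [lf|/large_image/Ag//] : large [set y | ~ small (f @^-1` [set y])] \/
    large (f @` [set z | ~ small (g @^-1` [set z])]).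
  apply: large_setU; apply: large_sub l => y /= nfg.
  apply: contrapT => /not_orP[/contrapT/smallE sf nim]; apply: nfg; apply/smallE => l.
  have [|z [fz lz]] := @large_cover _ _ _ (f @^-1` [set y]) (fun z => g @^-1` [set z]) l sf.
    by move=> x fgx; exists (g x).
  apply: nim; exists z => //= /smallE; apply.
  by apply: large_sub lz => x [].
exact: Af lf.
Qed.

Lemma monB_submonoid : is_submonoid (@monB X).
Proof.
split=> [y|f g Bf Bg y]; first by apply/smallE; apply: not_large_finite; exact: finite_set1.
apply/smallE => l; have /smallE sf := Bf y.
have [|z [_ lz]] := @large_cover _ _ _ (f @^-1` [set y]) (fun z => g @^-1` [set z]) l sf.
  by move=> x fgx; exists (g x).
by have /smallE := Bg z; apply; apply: large_sub lz => x [].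
Qed.

Lemma almost_surjective_comp (f g : X -> X) :
  almost_surjective f -> almost_surjective g -> almost_surjective (f \o g).
Proof.
move=> /smallE Ef /smallE Eg; apply/smallE => l.
have [//|/large_image//] : large (~` range f) \/ large (f @` (~` range g)).
apply: large_setU; apply: large_sub l => y nfg.
have [[x _ xy]|] := pselect (range f y); last by left.
right; exists x => // -[z _ zx]; apply: nfg; exists z => //=.
by rewrite zx.
Qed.

Lemma bijective_almost_surjective (f : X -> X) : bijective f -> almost_surjective f.
Proof.
move=> bf; apply/smallE; apply: not_large_finite.
suff -> : ~` range f = set0 by exact: finite_set0.
rewrite -subset0 => y; apply => //.
by have [x <-] := bij_surj bf y; exists x.
Qed.

Lemma monE_submonoid : is_submonoid (@monE X).
Proof.
split; last exact: almost_surjective_comp.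
by apply: bijective_almost_surjective; exists id.
Qed.

Lemma monF_submonoid : is_submonoid (@monF X).
Proof.
split=> [|f g]; first by left; exact: monE_submonoid.1.
move=> [Ef|[c fc]]; last by right; exists c => x; exact: fc.
move=> [Eg|[c gc]]; last by right; exists (f c) => x /=; rewrite gc.
by left; exact: almost_surjective_comp.
Qed.

(** If A has size L, then g maps the complement of A into the complement of a set of
    size L, to which the condition on f applies. *)
Lemma monG_submonoid (L : set X) : is_submonoid (monG L).
Proof.
split=> [A AL|f g Gf Gg A AL].
  rewrite image_id setCK.
  by have /card_eqPle[] := AL.
have /card_subP[B BL BA] := Gg A AL.
apply: card_le_trans (Gf B BL) _; apply: subset_card_le.
apply: subsetC => _ [x nAx <-]; exists (g x) => // /BA; apply.
by exists x.
Qed.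

Lemma listed_submonoid (G : set (X -> X)) : listed_monoid G -> is_submonoid G.
Proof.
case=> [||||L _]; [exact: monA_submonoid|exact: monB_submonoid|exact: monE_submonoid
  |exact: monF_submonoid|exact: monG_submonoid].
Qed.

Lemma injective_monB (f : X -> X) : injective f -> monB f.
Proof.
move=> fi y; apply/smallE => -[e [ei eP]].
have [z zpt] := another pt; apply: zpt; apply/ei/fi.
by rewrite [f _]eP [f _]eP.
Qed.

Lemma monB_monA (f : X -> X) : monB f -> monA f.
Proof.
move=> Bf; apply/smallE => -[e [_ eP]].
exact: (eP pt) (Bf _).
Qed.

Lemma listed_bijective (G : set (X -> X)) f : listed_monoid G -> bijective f -> G f.
Proof.
move=> LG bf; have fi := bij_inj bf.
case: LG => [||||L _].
- by apply: monB_monA; exact: injective_monB.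
- exact: injective_monB.
- exact: bijective_almost_surjective.
- by left; exact: bijective_almost_surjective.
- move=> A AL; apply: (@card_le_trans _ _ _ (f @` A)).
    have /card_eqPle[_ LA] := AL; apply: card_le_trans LA _.
    have /card_eqPle[] := @inj_card_eq _ _ A f (in2W fi); by [].
  by apply: subset_card_le => _ [x Ax <-] [y nAy /fi yx]; apply: nAy; rewrite yx.
Qed.

Lemma const_monA : monA (fun=> pt).
Proof.
apply/smallE => l; apply: (@not_large_finite X [set pt]); first exact: finite_set1.
apply: large_sub l => y /= ns; apply: contrapT => ny; apply: ns; apply/smallE.
move=> [e [_ /(_ pt) /= e']]; apply: ny; exact: esym e'.
Qed.

Lemma colarge_monG (L : set X) f : large (~` range f) -> monG L f.
Proof.
move=> l A _; apply: large_card_le; apply: large_sub l.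
by apply: subsetC => _ [x _ <-]; exists x.
Qed.

Lemma const_colarge : large (~` range (fun _ : X => pt)).
Proof.
apply: large_setC; apply: not_large_finite; apply: sub_finite_set (finite_set1 pt).
by move=> _ [x _ <-].
Qed.

Lemma const_not_monB : ~ monB (fun=> pt).
Proof. by move=> /(_ pt)/smallE; apply; exists id; split. Qed.

Lemma const_not_monE : ~ monE (fun=> pt).
Proof. by move=> /smallE; apply; exact: const_colarge. Qed.

Lemma half_not_monF : ~ monF half.
Proof.
case=> [/smallE|[c hc]]; first by apply; exact: (half_colarge (g := id)).
have [y yn] := another pt; apply: yn; apply: half_inj.
by rewrite !hc.
Qed.

Lemma manyfib_not_monA (f : X -> X) : manyfib f -> ~ monA f.
Proof. by move=> mf /smallE; apply; apply: large_sub mf => y l /smallE. Qed.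

Lemma pr1_manyfib : manyfib pr1.
Proof. by apply: large_sub large_setT => y _; exact: (@large_fiber_pr1 _ id). Qed.

Lemma pr1_monE : monE pr1.
Proof.
apply/smallE; apply: not_large_finite.
suff -> : ~` range pr1 = set0 by exact: finite_set0.
by rewrite -subset0 => y; apply; exists (pair y pt); rewrite ?pr1_pair.
Qed.

Let collapse := half \o pr1.

Lemma collapse_manyfib : manyfib collapse.
Proof.
apply: large_sub (large_range half_inj) => _ [x _ <-].
exact: (@large_fiber_pr1 _ half).
Qed.

Lemma collapse_colarge : large (~` range collapse).
Proof. by rewrite range_pr1; exact: (half_colarge (g := id)). Qed.

Lemma collapse_not_monF : ~ monF collapse.
Proof.
case=> [/smallE|[c hc]]; first by apply; exact: collapse_colarge.
have [y yn] := another pt; apply: yn; apply: half_inj.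
by have := hc (pair pt pt); rewrite -(hc (pair y pt)) /collapse /= !pr1_pair.
Qed.

(** The function d maps each half of X bijectively onto X, so it stays surjective
    when points of one half are removed. *)
Lemma fold_exists : exists d : X -> X, [/\ monB d, monE d &
  forall L : set X, L !=set0 -> ~ monG L d].
Proof.
have [e [ei eR]] := large_enumX (half_colarge (g := id) (fun _ _ => id)).
have eh x y : e x <> half y.
  move=> exy; have : (~` range (id \o half)) (e x) by rewrite -eR; exists x.
  by apply; exists y.
have /choice[d dP] : forall x, exists y, x = half y \/ x = e y.
  move=> x; have [[y _ <-]|nx] := pselect (range (id \o half) x); first by exists y; left.
  have [y _ yx] : range e x by rewrite eR.
  by exists y; right.
have dh x : d (half x) = x by have [/half_inj|/esym/eh] := dP (half x).
exists d; split.
- move=> y; apply/smallE; apply: not_large_finite.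
  apply: sub_finite_set (finite_set2 (half y) (e y)) => x /= <-.
  by have := dP x.
- apply/smallE; apply: not_large_finite.
  suff -> : ~` range d = set0 by exact: finite_set0.
  by rewrite -subset0 => y; apply; exists (half y).
- move=> L [x0 Lx0] /(_ (e @` L) (inj_card_eq (in2W ei))).
  have -> : ~` (d @` (~` (e @` L))) = set0.
    rewrite -subset0 => y; apply; exists (half y) => // -[z _].
    exact: eh.
  by move=> /card_le0P L0; rewrite L0 in Lx0.
Qed.

(** * Operations that are not almost unary *)

Definition rectangular (B : X -> X -> X) := exists u v : X -> X,
  forall a b a' b', B (u a) (v b) = B (u a') (v b') -> a = a' /\ b = b'.

(** Half of the arguments of split_op serve to copy that argument, so that an almost
    surjective argument forces an almost surjective value; the others leave room for
    a copy of the square. *)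
Definition split_op x y := if pselect (pr1 x = pt) then
  if pselect (pr1 y = pt) then pair x y else pr2 y else pr2 x.

Lemma split_op_range (g1 g2 : X -> X) :
  almost_surjective g1 \/
    (exists2 c, pr1 c = pt & forall x, g1 x = c) /\ almost_surjective g2 ->
  almost_surjective (fun x => split_op (g1 x) (g2 x)).
Proof.
have aux (g : X -> X) : almost_surjective g ->
    (forall x, pr1 (g x) <> pt -> split_op (g1 x) (g2 x) = pr2 (g x)) ->
    almost_surjective (fun x => split_op (g1 x) (g2 x)).
  move=> /smallE Eg gP; apply/smallE; apply: contra_not Eg => l.
  have : large (pair pt' @` (~` range (fun x => split_op (g1 x) (g2 x)))).
    by apply: image_large l => x y _ _ /pair_inj[].
  apply: large_sub => _ [y ny <-] [x _ gx]; apply: ny; exists x => //.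
  by rewrite gP gx ?pr2_pair // pr1_pair; exact: pt'P.
case=> [E1|[[c cpt g1c] E2]]; first by apply: (aux g1) => // x nx; rewrite /split_op if_fails.
by apply: (aux g2) => // x nx; rewrite /split_op g1c if_holds // if_fails.
Qed.

(** For A and B a pairing function works, since a fibre of the pair is contained in
    fibres of both components; for the monoids of type G it works with co-large
    range. *)
Lemma listed_rectangular (G : set (X -> X)) : listed_monoid G ->
  exists B, Pol G (op (bin B)) /\ rectangular B.
Proof.
have split_rect : rectangular split_op.
  exists half, half => a b a' b'; rewrite /split_op !if_holds ?pr1_pair //.
  by move=> /pair_inj[/half_inj ? /half_inj].
have pair_rect : rectangular pair by exists id, id => a b a' b' /pair_inj.
case=> [||||L _].
- exists pair; split=> //; apply/Pol_bin => g1 g2 /smallE A1 /smallE A2.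
  apply/smallE => l.
  have [|a [_ la]] := @large_cover _ _ _ [set y | ~ small (g1 @^-1` [set y])]
      (fun a => [set y | pr1 y = a]) l A1.
    move=> y /= /smallE/contrapT ly; exists (pr1 y); split=> // /smallE; apply.
    by apply: large_sub ly => x /= <-; rewrite pr1_pair.
  apply: A2; apply: (large_sub _ (image_large (F := pr2) _ la)).
    move=> _ [y [/= /smallE/contrapT ly _] <-] /smallE; apply.
    by apply: large_sub ly => x /= <-; rewrite pr2_pair.
  by move=> y z [_ /= ya] [_ /= za] e; rewrite -(pair_pr y) -(pair_pr z) ya za e.
- exists pair; split=> //; apply/Pol_bin => g1 g2 B1 _ y; apply/smallE.
  have /smallE := B1 (pr1 y); apply: contra_not; apply: large_sub => x /= <-.
  by rewrite pr1_pair.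
- exists split_op; split=> //; apply/Pol_bin => g1 g2 E1 _.
  by apply: split_op_range; left.
- exists split_op; split=> //; apply/Pol_bin => g1 g2 [E1|[c g1c]].
    by move=> _; left; apply: split_op_range; left.
  have [cpt|nc] := pselect (pr1 c = pt); last first.
    by move=> _; right; exists (pr2 c) => x; rewrite /split_op g1c if_fails.
  move=> [E2|[c' g2c]]; last by right; exists (split_op c c') => x; rewrite g1c g2c.
  by left; apply: split_op_range; right; split=> //; exists c.
- exists (fun x y => half (pair x y)); split; last first.
    by exists id, id => a b a' b' /half_inj/pair_inj.
  apply/Pol_bin => g1 g2 _ _; apply: colarge_monG.
  have := half_colarge (g := id) (fun _ _ => id); apply: large_sub.
  by apply: subsetC => _ [x _ <-]; exists (pair (g1 x) (g2 x)).
Qed.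

Definition almost_unary : set (operation X) :=
  [set o | let: existT n f := o in exists i, forall c, ~ large (f @` [set r | r i = c])].

Lemma almost_unary_clone : is_clone almost_unary.
Proof.
split=> [n i|n m f g [i fi] Ug].
  exists i => c; apply: not_large_finite; apply: sub_finite_set (finite_set1 c).
  by move=> _ [r /= <- <-].
have [j gj] := Ug i; exists j => c l.
have [|d [_ ld]] := @large_cover _ _ _ (g i @` [set r | r j = c])
    (fun d => f @` [set r | r i = d]) l (gj c).
  move=> _ [r /= rc <-]; exists (g i r); split; first by exists r.
  by exists (fun i => g i r).
by apply: (fi d); apply: large_sub ld => y [].
Qed.

Lemma unary_almost_unary f : almost_unary (unary_op f).
Proof.
exists ord0 => c; apply: not_large_finite; apply: sub_finite_set (finite_set1 (f c)).
by move=> _ [r /= <- <-].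
Qed.

Lemma pair_not_almost_unary : ~ almost_unary (op (bin pair)).
Proof.
move=> [i /(_ pt)]; apply; have [->|ni] := eqVneq i ord0.
  exists (pair pt); split=> [x y /pair_inj[]//|x].
  by exists (fun i => if i == ord0 then pt else x).
exists (pair^~ pt); split=> [x y /pair_inj[]//|x].
exists (fun i => if i == ord0 then x else pt) => //=.
by rewrite (negbTE ni).
Qed.

Lemma rectangular_wide B : rectangular B ->
  forall i, exists c, large (bin B @` [set r | r i = c]).
Proof.
move=> [u [v uv]] i; have [->|ni] := eqVneq i ord0.
  exists (u pt), (fun b => B (u pt) (v b)); split=> [x y /uv[]//|x].
  by exists (fun i => if i == ord0 then u pt else v x).
exists (v pt), (fun a => B (u a) (v pt)); split=> [x y /uv[]//|x].
exists (fun i => if i == ord0 then u x else v pt) => //=.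
by rewrite (negbTE ni).
Qed.

(** Iterating B gives injections of the finite powers of X into X, and every
    operation is a unary function of such a code of its arguments. *)
Lemma rectangular_full (D : set (operation X)) B : is_clone D ->
  (forall f, D (unary_op f)) -> D (op (bin B)) -> rectangular B -> D = setT.
Proof.
move=> Dc Du DB [u [v uv]].
have Dpost n (h : X -> X) (f : nary X n.+1) : D (op f) -> D (op (fun r => h (f r))).
  by move=> Df; exact: (clone_comp Dc (Du h) (fun=> Df)).
have code_all n : exists P : nary X n.+1, D (op P) /\ injective P.
  elim: n => [|n [P [DP Pi]]].
    exists (fun r => r ord0); split; first exact: (clone_proj Dc).
    by move=> r s e; apply/funext => i; rewrite (ord1 i).
  pose Q : nary X n.+2 := fun r => P (fun i => r (lift ord0 i)).
  have DQ : D (op Q).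
    by apply: (clone_comp Dc DP (fun i => clone_proj Dc (lift ord0 i))).
  exists (fun r => B (u (r ord0)) (v (Q r))); split.
    pose g (i : 'I_2) : nary X n.+2 :=
      if i == ord0 then fun r => u (r ord0) else fun r => v (Q r).
    apply: (clone_comp Dc DB (g := g)) => i; rewrite /g; case: ifP => _.
      exact: (Dpost _ _ (fun r => r ord0) (clone_proj Dc ord0)).
    exact: Dpost.
  move=> r s /uv[e0 /Pi eQ]; apply/funext => i.
  have [j ->|->//] := unliftP ord0 i.
  exact: (congr1 (fun k : 'I_n.+1 -> X => k j) eQ).
apply/seteqP; split=> // -[n f] _; have [P [DP Pi]] := code_all n.
have /choice[k kP] : forall y, exists z, forall r, P r = y -> f r = z.
  move=> y; have [[r ry]|nr] := pselect (exists r, P r = y).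
    by exists (f r) => s sy; congr f; apply: Pi; rewrite sy ry.
  by exists pt => r ry; case: nr; exists r.
have -> : f = fun r => k (P r) by apply/funext => r; exact: kP.
exact: Dpost.
Qed.

(** * Incomparability *)

Lemma Pol_sub_unary (G H : set (X -> X)) : listed_monoid G -> listed_monoid H ->
  Pol G `<=` Pol H -> G `<=` H.
Proof.
move=> LG LH GH f Gf.
by apply/(Pol_unary f (listed_submonoid LH)); apply: GH; apply/Pol_unary => //;
  exact: listed_submonoid.
Qed.

(** The value of switch at (g1, g2) differs from g1 only on the fibre of g1 over pt,
    so it inherits from g1 that fibres are small and that almost all values are
    attained. With the constant pt as first argument it becomes collapse, which is
    neither in A nor in F. *)
Let switch x y := if pselect (x = pt) then collapse y else x.

Lemma switch_Pol_monB : Pol (@monB X) (op (bin switch)).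
Proof.
apply/Pol_bin => g1 g2 B1 _ y; apply/smallE => l.
have /large_setU[] : large (g1 @^-1` [set pt] `|` g1 @^-1` [set y]).
- by apply: large_sub l => x /=; rewrite /switch; case: pselect; [left|right].
- by have /smallE := B1 pt.
- by have /smallE := B1 y.
Qed.

Lemma switch_Pol_monE : Pol (@monE X) (op (bin switch)).
Proof.
apply/Pol_bin => g1 g2 /smallE E1 _; apply/smallE => l; apply: E1.
have := large_setD l (@not_large_finite _ [set pt] (finite_set1 _)).
apply: large_sub => y [ny nypt] [x _ xy]; apply: ny; exists x => //.
by rewrite /switch if_fails xy.
Qed.

Lemma switch_not_Pol (H : set (X -> X)) : listed_monoid H -> H (fun=> pt) ->
  ~ H collapse -> ~ Pol H (op (bin switch)).
Proof.
move=> LH Hc nhp /Pol_bin/(_ (fun=> pt) id Hc (listed_submonoid LH).1).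
suff -> : (fun x => switch pt (id x)) = collapse by [].
by apply/funext => x; rewrite /switch if_holds.
Qed.

(** A set of any size can be removed from the arguments without emptying a fibre of
    d, so that d still misses only L. *)
Lemma skip_exists (L : set X) : ~ large L -> exists d : X -> X,
  [/\ bigfib d, range d = ~` L, monG L d & forall M : set X, monG M d -> M #<= L].
Proof.
move=> nL; have [e [_ eL]] := large_setC nL.
have [r [rL rid]] := retraction (eL pt).
have dR : range (r \o pr1) = ~` L.
  rewrite range_pr1; apply/seteqP; split=> [_ [x _ <-]|x Lx]; first exact: rL.
  by exists x => //; exact: rid.
exists (r \o pr1); split=> //; first exact: bigfib_pr1.
  move=> A _; rewrite -{1}[L]setCK -dR; apply: subset_card_le.
  by apply: subsetC => _ [x _ <-]; exists x.
move=> M /(_ ((pair^~ pt) @` M)) GM.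
have := GM (inj_card_eq (in2W (fun x y (e : pair x pt = pair y pt) => (pair_inj e).1))).
suff -> : (r \o pr1) @` (~` ((pair^~ pt) @` M)) = ~` L by rewrite setCK.
apply/seteqP; split=> [_ [x _ <-]|x Lx]; first exact: rL.
exists (pair x pt'); last by rewrite /= pr1_pair rid.
by move=> [y _ /pair_inj[_ /esym/pt'P]].
Qed.

(** If M does not embed into L, then L is small and a function omitting exactly L
    separates the monoids. If L does not embed into M, then M is small; let g have
    large fibres and omit exactly M, and let f be surjective with its only
    repetition on M, so that f is not in the monoid of M. The operation B gives f at
    the arguments g and id. It preserves the monoid of L: if L does not embed into
    what B(g1,g2) misses, which is then small, the set Y of points where g1 = g g2
    is mapped by g2 onto almost all of X. Then g1 attains all values of g already on
    a transversal, and its complement has room for a set of size L; so L embeds into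
    M if g1 is in the monoid of L. *)
Lemma Pol_monG_le (L M : set X) : L !=set0 -> M !=set0 ->
  Pol (monG L) `<=` Pol (monG M) -> M #<= L /\ L #<= M.
Proof.
move=> L0 M0 LM; have := Pol_sub_unary (listed_G L0) (listed_G M0) LM => sub.
split.
  have [lL|nL] := pselect (large L); first exact: large_card_le.
  by have [d [_ _ Ld]] := skip_exists nL; apply; exact: sub.
have [lM|nM] := pselect (large M); first exact: large_card_le.
apply: contrapT => nLM.
have [g [gb gR gM _]] := skip_exists nM.
have [e [ei eR]] := large_enumX (large_setC nM).
have eM x : ~ M (e x) by have : (~` M) (e x) by rewrite -eR; exists x.
have /choice[f fP] : forall x, exists y, (M x -> y = pt) /\ (~ M x -> e y = x).
  move=> x; have [Mx|nMx] := pselect (M x); first by exists pt.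
  have [y _ yx] : range e x by rewrite eR.
  by exists y.
have fe x : f (e x) = x by apply: ei; exact: (fP _).2.
pose B x y := if pselect (x = g y) then f y else pt.
suff /LM/Pol_bin/(_ g id gM (monG_submonoid M).1) : Pol (monG L) (op (bin B)).
  have -> : (fun x => B (g x) (id x)) = f by apply/funext => x; rewrite /B if_holds.
  move=> /(_ M (card_eqxx _)).
  have -> : ~` (f @` (~` M)) = set0.
    by rewrite -subset0 => y; apply; exists (e y) => //; exact: eM.
  by move=> /card_le0P M0'; case: M0 => x; rewrite M0'.
apply/Pol_bin => g1 g2 G1 _ A AL; apply: contrapT => nLA; apply: nLM.
set F := fun x => _ in nLA.
have nF : ~ large (~` range F).
  move=> l; apply: nLA; apply: large_card_le; apply: large_sub l.
  by apply: subsetC => _ [x _ <-]; exists x.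
pose Y := [set y | g1 y = g (g2 y)].
have nZ : ~ large (~` (g2 @` Y)).
  move=> l.
  have /large_setU[/large_setU[]//|] : large (M `|` [set e pt] `|` e @` (~` range F)).
  - apply: large_sub l => x nx; have [Mx|nMx] := pselect (M x); first by left; left.
    have ex : e (f x) = x by exact: (fP x).2.
    have [fx|fx] := pselect (f x = pt); first by left; right; rewrite -fx.
    right; exists (f x) => // -[y _ Fy]; apply: nx; move: Fy; rewrite /F /B.
    case: pselect => [yY fg|_ /esym//]; exists y => //.
    have {}fg : f (g2 y) = f x by exact: fg.
    have nM2 : ~ M (g2 y) by move=> /(fP _).1 fpt; apply: fx; rewrite -fg.
    by rewrite -(proj2 (fP (g2 y)) nM2) fg.
  - exact: not_large_finite (finite_set1 _).
  - by move/large_image.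
have fibZ x : large ([set z | g z = g x] `\` ~` (g2 @` Y)) by exact: large_setD (gb x) nZ.
have /choice[T TP] : forall p, exists y, range g p -> [/\ Y y & g (g2 y) = p].
  move=> p; have [[x _ <-]|np] := pselect (range g p); last by exists pt => /np.
  have [k [_ /(_ pt)[/= kx /contrapT[y Yy yk]]]] := fibZ x.
  by exists y => _; split=> //; rewrite yk.
have lT : large (~` (T @` range g)).
  have [k [ki kP]] := fibZ pt.
  have /choice[y yP] : forall w, exists y, Y y /\ g2 y = k w.
    by move=> w; have [_ /contrapT[y Yy yk]] := kP w; exists y.
  have ly : large (range y).
    by apply: large_range => w w' e'; apply: ki; rewrite -(yP w).2 e' (yP w').2.
  apply: large_sub (large_setD ly (@not_large_finite _ [set T (g pt)] (finite_set1 _))).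
  move=> _ [[w _ <-] nT] [p gp Tp]; apply: nT; rewrite /= -Tp; congr T.
  have [_ <-] := TP p gp; rewrite Tp (yP w).2.
  by have [] := kP w.
have [k [ki kP]] := lT.
have := G1 (k @` L) (inj_card_eq (in2W ki)).
move/card_le_trans; apply; rewrite -[M]setCK -gR; apply: subset_card_le.
apply: subsetC => p gp; have [Yp <-] := TP p gp.
by exists (T p) => // -[w _ wT]; apply: (kP w); exists p.
Qed.

Lemma card_eq_monG (L M : set X) : L #= M -> monG L = monG M.
Proof.
move=> LM; have /card_eqPle[L_M M_L] := LM.
apply/seteqP; split=> f Gf A AM.
  apply: card_le_trans M_L _; apply: Gf; exact: card_eq_trans AM (card_esym LM).
by apply: card_le_trans L_M _; apply: Gf; exact: card_eq_trans AM LM.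
Qed.

Lemma Pol_listed_inj (G H : set (X -> X)) : listed_monoid G -> listed_monoid H ->
  Pol G `<=` Pol H -> G = H.
Proof.
move=> LG LH GH; have sub := Pol_sub_unary LG LH GH.
have [d [dB dE dG]] := fold_exists; have dA := monB_monA dB.
have hB := injective_monB half_inj; have hA := monB_monA hB.
have pnA := manyfib_not_monA pr1_manyfib.
have collapse_nA := manyfib_not_monA collapse_manyfib.
have nsub f : G f -> ~ H f -> G = H by move=> /sub.
have collapseG L : monG L collapse by apply: colarge_monG; exact: collapse_colarge.
case: LG sub GH nsub => [||||L L0]; case: LH => [||||M M0] sub GH nsub //.
- exact: (nsub (fun=> pt) const_monA const_not_monB).
- exact: (nsub (fun=> pt) const_monA const_not_monE).
- exact: (nsub half hA half_not_monF).
- exact: (nsub d dA (dG _ M0)).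
- case: (switch_not_Pol (listed_A X) const_monA collapse_nA); apply: GH.
  exact: switch_Pol_monB.
- by apply: (nsub half hB) => e; apply: half_not_monF; left.
- exact: (nsub half hB half_not_monF).
- exact: (nsub d dB (dG _ M0)).
- exact: (nsub pr1 pr1_monE pnA).
- by apply: (nsub pr1 pr1_monE) => /monB_monA.
- case: (switch_not_Pol (listed_F X) _ collapse_not_monF); first by right; exists pt.
  by apply: GH; exact: switch_Pol_monE.
- exact: (nsub d dE (dG _ M0)).
- by apply: (nsub pr1 _ pnA); left; exact: pr1_monE.
- by apply: (nsub pr1) => [|/monB_monA//]; left; exact: pr1_monE.
- by apply: (nsub (fun=> pt) _ const_not_monE); right; exists pt.
- by apply: (nsub d _ (dG _ M0)); left.
- exact: (nsub collapse (collapseG _) collapse_nA).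
- by apply: (nsub collapse (collapseG _)) => /monB_monA.
- by apply: (nsub collapse (collapseG _)) => e; apply: collapse_not_monF; left.
- exact: (nsub collapse (collapseG _) collapse_not_monF).
- apply: card_eq_monG; have [ML LM] := Pol_monG_le L0 M0 GH.
  by apply/card_eqPle.
Qed.

Lemma listed_proper (G : set (X -> X)) : listed_monoid G -> exists f, ~ G f.
Proof.
have [d [dB dE dG]] := fold_exists.
case=> [||||L L0].
- by exists pr1; exact: manyfib_not_monA pr1_manyfib.
- by exists (fun=> pt); exact: const_not_monB.
- by exists (fun=> pt); exact: const_not_monE.
- by exists half; exact: half_not_monF.
- by exists d; exact: dG.
Qed.

Lemma Pol_listed_proper (G : set (X -> X)) : listed_monoid G -> Pol G <> setT.
Proof.
move=> LG PT; have [f nGf] := listed_proper LG; apply: nGf.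
by apply/(Pol_unary f (listed_submonoid LG)); rewrite PT.
Qed.

(** * Maximal clones *)

Lemma unary_sub_or_listed (D : set (operation X)) : is_clone D ->
  (forall f : X -> X, bijective f -> D (unary_op f)) ->
  (exists n (f : nary X n.+1), D (op f) /\
    forall i, exists c, large (f @` [set r | r i = c])) ->
  (forall f, D (unary_op f)) \/ exists G, listed_monoid G /\ D `<=` Pol G.
Proof.
move=> Dc Db Dw; have [|nG] := pselect (exists G, listed_monoid G /\ D `<=` Pol G).
  by right.
left=> h; have nD G : listed_monoid G -> ~ D `<=` Pol G.
  by move=> LG DG; apply: nG; exists G.
by apply: M_full => //; [move=> L L0|..]; apply: nD; constructor.
Qed.

Lemma maximal_over_perm_listed (C : set (operation X)) : maximal_clone C ->
  (forall f : X -> X, bijective f -> C (unary_op f)) ->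
  ~ (forall f : X -> X, C (unary_op f)) ->
  exists G, listed_monoid G /\ C = Pol G.
Proof.
move=> [Cc CT Cmax] Cb Cu.
have [//||[G [LG CG]]] := unary_sub_or_listed Cc Cb _; last first.
- exists G; split=> //; apply/esym; apply: Cmax => //; first exact: Pol_clone.
  exact: Pol_listed_proper.
- by move/Cu.
apply: contrapT => nw; apply: Cu => h.
have <- : almost_unary = C; last exact: unary_almost_unary.
apply: Cmax.
- exact: almost_unary_clone.
- move=> [n f] Cf; apply: contrapT => nU; apply: nw; exists n, f; split=> // i.
  apply: contrapT => nc; apply: nU; exists i => c l; apply: nc.
  by exists c.
- by move=> UT; apply: pair_not_almost_unary; rewrite UT.
Qed.

Lemma Pol_listed_maximal (G : set (X -> X)) : listed_monoid G -> maximal_clone (Pol G).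
Proof.
move=> LG; split=> [||D Dc GD DT]; first exact: Pol_clone.
  exact: Pol_listed_proper.
have [B [PB rB]] := listed_rectangular LG.
have [||Du|[H [LH DH]]] := unary_sub_or_listed Dc.
- move=> f bf; apply: GD; apply/(Pol_unary f (listed_submonoid LG)).
  exact: listed_bijective.
- by exists 1, (bin B); split; [exact: GD|exact: rectangular_wide].
- case: DT; apply: (rectangular_full Dc Du _ rB); exact: GD.
- have GH : G = H by apply: Pol_listed_inj => //; exact: subset_trans DH.
  by apply/seteqP; split=> //; rewrite GH.
Qed.
End Cardinals.

Theorem theorem72 (X : Type) (hX : infinite_regular X) :
  (forall G : set (X -> X), listed_monoid G -> is_submonoid G) /\
  (forall C : set (operation X),
     (maximal_clone C /\
      (forall f : X -> X, bijective f -> C (unary_op f)) /\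
      ~ (forall f : X -> X, C (unary_op f)))
     <->
     (exists G : set (X -> X), listed_monoid G /\ C = Pol G)).
Proof.
split=> [G|C]; first exact: listed_submonoid.
split=> [[Cmax [Cb Cu]]|[G [LG ->]]]; first exact: maximal_over_perm_listed.
have Gu f : Pol G (unary_op f) <-> G f by apply: Pol_unary; exact: listed_submonoid.
split; first exact: Pol_listed_maximal.
split=> [f bf|all]; first by apply/Gu; exact: listed_bijective.
have [f nGf] := listed_proper hX LG.
exact/nGf/Gu.
Qed.
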